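(* Let $w$ be a weight function on $[0,\infty)$, let $A:=L_0^\infty(w)^*$ be equipped with the first Arens product, let $k\in\mathbb{N}$ (with $k\geq 1$), let $\theta:A\to A$ be a homomorphism and let $D:A\to A$ be a $\theta$-derivation. Then $D$ is $k$-centralizing if and only if $D$ is $k$-commuting. In this case (i.e. when $D$ is $k$-centralizing), if moreover $\theta$ is an isometric isomorphism of $A$ onto itself, then for every $u\in\Lambda(A)$ the map $D$ sends $A$ into $uA$ and $D(m)=\theta(u)D(m)$ for all $m\in A$.
   Context: A weight function is a continuous function $w:[0,\infty)\to[1,\infty)$ with $w(0)=1$ and $w(x+y)\le w(x)w(y)$ for all $x,y\ge 0$. $L^1(w)$ is the Banach space of (classes of) complex Lebesgue measurable functions $\varphi$ on $[0,\infty)$ with $\|\varphi\|_w=\int_0^\infty w(x)|\varphi(x)|\,dx<\infty$. $L_0^\infty(w)$ is the Banach space of (classes of) complex Lebesgue measurable functions $f$ on $[0,\infty)$ such that $f/w$ is essentially bounded and $\lim_{x\to\infty}\operatorname{ess\,sup}_{y>x}|f(y)|/w(y)=0$, with norm $\operatorname{ess\,sup}|f|/w$. For $f\in L_0^\infty(w)$ and $\varphi\in L^1(w)$ let $(f\varphi)(x)=\int_0^\infty f(x+y)\varphi(y)\,dy$ for $x\ge 0$, which defines an element of $L_0^\infty(w)$. For $n\in L_0^\infty(w)^*$ and $f\in L_0^\infty(w)$, $nf\in L_0^\infty(w)$ is the element determined by $\int_0^\infty (nf)(x)\varphi(x)\,dx=\langle n,f\varphi\rangle$ for all $\varphi\in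 L^1(w)$. The dual $A=L_0^\infty(w)^*$ is a Banach algebra under the first Arens product $\langle mn,f\rangle=\langle m,nf\rangle$. $\Lambda(A)$ is the set of right identities of $A$ (elements $u$ with $mu=m$ for all $m\in A$) of norm one. $uA=\{um:m\in A\}$. $Z(A)=\{a\in A: ax=xa\text{ for all }x\in A\}$ is the center. A homomorphism is a linear multiplicative map $A\to A$; an isomorphism on $A$ is a bijective homomorphism $A\to A$. Given a homomorphism $\theta$, a $\theta$-derivation on $A$ is a linear map $D:A\to A$ (no continuity assumed) with $D(mn)=D(m)\theta(n)+\theta(m)D(n)$ for all $m,n\in A$. A linear map $D:A\to A$ is $k$-centralizing if $[D(m),m^k]:=D(m)m^k-m^kD(m)\in Z(A)$ for all $m\in A$, and $k$-commuting if $[D(m),m^k]=0$ for all $m\in A$. *)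

(* Defs.v *)
From HB Require Import structures.
From mathcomp Require Import all_boot all_order all_algebra.
From mathcomp Require Import complex.
From mathcomp Require Import all_classical all_reals all_analysis.
From mathcomp Require Import measurable_realfun ess_sup_inf.

Set Implicit Arguments.
Unset Strict Implicit.
Unset Printing Implicit Defensive.

Import Order.TTheory GRing.Theory Num.Theory.
Import numFieldNormedType.Exports.
Import Normc.

Local Open Scope classical_set_scope.
Local Open Scope ring_scope.

(* A function on [0, +oo[ is represented by a total function on R whose values
   at negative reals are irrelevant. *)
Record weight (R : realType) := Weight {
  weight_fun :> R -> R;
  weight_continuous : {within `[0, +oo[, continuous weight_fun};
  weight_ge1 : forall x, 0 <= x -> 1 <= weight_fun x;
  weight0 : weight_fun 0 = 1;
  weight_submul : forall x y, 0 <= x -> 0 <= y ->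
    weight_fun (x + y) <= weight_fun x * weight_fun y
}.

Section complex_functions.
Context {R : realType}.
Local Notation mu := (@lebesgue_measure R).
Implicit Types (D : set R) (i : interval R) (f : R -> R[i]).

(* The sigma-algebra on R is the Borel one. As every Lebesgue measurable
   function is equal almost everywhere to a Borel one, this does not change the
   spaces of classes below. *)
Definition cmeasurable_fun D f :=
  measurable_fun D (fun x => complex.Re (f x)) /\
  measurable_fun D (fun x => complex.Im (f x)).

Definition Cintegral D f : R[i] :=
  (\int[mu]_(x in D) complex.Re (f x) +i* \int[mu]_(x in D) complex.Im (f x))%C.

Definition ess_sup_itv i (g : R -> R) : \bar R :=
  ess_sup (mrestr mu (measurable_itv i)) (EFin \o g).

End complex_functions.

Section L1w.
Context {R : realType} (w : weight R).

Definition L1 (phi : R -> R[i]) :=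
  cmeasurable_fun `[0, +oo[ phi /\
  (\int[lebesgue_measure]_(x in `[0%R, +oo[) (w x * normc (phi x))%:E < +oo)%E.

End L1w.

Section L0inf.
Context {R : realType} (w : weight R).
Implicit Types f g : R -> R[i].

Definition wquot f (x : R) : R := normc (f x) / w x.

Definition isL0inf f :=
  [/\ cmeasurable_fun `[0, +oo[ f,
      (ess_sup_itv `[0%R, +oo[ (wquot f) < +oo)%E &
      ess_sup_itv `]x, +oo[ (wquot f) @[x --> +oo] --> 0%E].

Definition L0inf_pred : {pred R -> R[i]^o} := mem [set f | isL0inf f].

Lemma weight_gt0 x : 0 <= x -> 0 < w x.
Proof. by move=> x0; exact: lt_le_trans ltr01 (weight_ge1 w x0). Qed.

Lemma ae_mem_itv (i : interval R) :
  \forall x \ae mrestr lebesgue_measure (measurable_itv i), x \in i.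
Proof.
exists (~` [set` i]); split => //; first exact: (measurableC (measurable_itv i)).
by rewrite /= /mrestr setICl measure0.
Qed.

Lemma ess_sup_itv_ge0 (i : interval R) f : [set` i] `<=` `[0, +oo[ ->
  (0 < lebesgue_measure [set` i])%E -> (0 <= ess_sup_itv i (wquot f))%E.
Proof.
move=> iD mui; apply: ess_sup_gee; first by rewrite /= /mrestr setTI.
apply: (@filterS _ _ (ae_filter_ringOfSetsType _) _ _ _ (ae_mem_itv i)) => x ix.
rewrite lee_fin /wquot divr_ge0//.
  by case: (f x) => a b; exact: sqrtr_ge0.
by apply/ltW/weight_gt0; have := iD _ ix; rewrite /= in_itv/= andbT.
Qed.

Lemma ess_sup_itv_linear (i : interval R) (a : R[i]) f g :
  [set` i] `<=` `[0, +oo[ ->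
  (ess_sup_itv i (wquot (fun x => a * f x + g x)%R) <=
   (normc a)%:E * ess_sup_itv i (wquot f) + ess_sup_itv i (wquot g))%E.
Proof.
move=> iD; apply/ess_supP.
have a0 : 0 <= normc a by case: (a) => ? ?; exact: sqrtr_ge0.
have fE := ess_sup_ge (mrestr lebesgue_measure (measurable_itv i))
  (EFin \o wquot f).
have gE := ess_sup_ge (mrestr lebesgue_measure (measurable_itv i))
  (EFin \o wquot g).
apply: (@filterS3 _ _ (ae_filter_ringOfSetsType _) _ _ _ _ _
  (ae_mem_itv i) fE gE) => x ix fx gx.
apply: le_trans (leeD (lee_wpmul2l _ fx) gx); rewrite ?lee_fin//.
have w0 : 0 < w x.
  by apply: weight_gt0; have := iD _ ix; rewrite /= in_itv/= andbT.
rewrite /wquot mulrA -mulrDl ler_pM2r ?invr_gt0//.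
by rewrite -normcM; exact: le_normcD.
Qed.

Lemma L0inf_submod_closed : submod_closed L0inf_pred.
Proof.
have D0 : (0 < @lebesgue_measure R `[0%R, +oo[)%E.
  by rewrite lebesgue_measure_itv/= ltry ltry.
split.
  have w0 : wquot (0 : R -> R[i]^o) = cst 0.
    by apply/funext => x; rewrite /wquot /= expr0n/= addr0 sqrtr0 mul0r.
  have E0 i : (0 < @lebesgue_measure R [set` i])%E ->
      ess_sup_itv i (wquot (0 : R -> R[i]^o)) = 0%E.
    move=> i0; rewrite /ess_sup_itv w0 -[RHS](@ess_sup_cst _ _ _
      (mrestr lebesgue_measure (measurable_itv i)) 0%E)//.
    by rewrite /= /mrestr setTI.
  rewrite inE; split; first by split; exact: measurable_cst.
    by rewrite E0 ?ltry.
  under eq_fun do rewrite E0 ?lebesgue_measure_itv/= ?ltry//.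
  exact: cvg_cst.
move=> a f g; rewrite !inE => -[[fr fi] ff f0] [[gr gi] gf g0]; split.
- split.
    rewrite (_ : (fun x => _) = (fun x => complex.Re a * complex.Re (f x) -
        complex.Im a * complex.Im (f x) + complex.Re (g x))); last first.
      by apply/funext => x; rewrite -[LHS]/(complex.Re (a * f x + g x));
        case: a (f x) (g x) => [? ?] [? ?] [? ?].
    apply: measurable_funD => //; apply: measurable_funB;
      apply: measurable_funM => //; exact: measurable_cst.
  rewrite (_ : (fun x => _) = (fun x => complex.Re a * complex.Im (f x) +
      complex.Im a * complex.Re (f x) + complex.Im (g x))); last first.
    by apply/funext => x; rewrite -[LHS]/(complex.Im (a * f x + g x));
      case: a (f x) (g x) => [? ?] [? ?] [? ?].
  apply: measurable_funD => //; apply: measurable_funD;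
    apply: measurable_funM => //; exact: measurable_cst.
- apply: le_lt_trans (ess_sup_itv_linear a f g _) _ => //.
  have E h : (ess_sup_itv `[0%R, +oo[ (wquot h) < +oo)%E ->
      ess_sup_itv `[0%R, +oo[ (wquot h) \is a fin_num.
    by move=> ?; rewrite ge0_fin_numE ?ess_sup_itv_ge0.
  by rewrite lte_add_pinfty// -(fineK (E _ ff)) -EFinM ltry.
- apply: (@squeeze_cvge _ _ _ _ (cst 0%E) _ (fun x =>
    (normc a)%:E * ess_sup_itv `]x, +oo[ (wquot f) +
    ess_sup_itv `]x, +oo[ (wquot g))%E).
  + near=> x.
    have xD : `]x, +oo[ `<=` `[0%R, +oo[.
      move=> y; rewrite /= !in_itv/= !andbT => /ltW; apply: le_trans.
      by near: x; exact: nbhs_pinfty_ge.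
    rewrite ess_sup_itv_linear// andbT.
    by apply: ess_sup_itv_ge0; rewrite // lebesgue_measure_itv/= ltry addye.
  + exact: cvg_cst.
  + rewrite -[X in _ --> X]adde0 -[X in _ --> (X + _)%E](mule0 (normc a)%:E).
    apply: cvgeD => //.
    exact: (@cvgeZl _ _ _ _ 0%E).
Unshelve. all: by end_near. Qed.

HB.instance Definition _ :=
  GRing.isSubmodClosed.Build _ _ L0inf_pred L0inf_submod_closed.

(* The elements are functions; the classes are recovered by only considering
   functionals that are bounded for the seminorm [normw]. *)
Record L0inf : Type := mkL0inf {
  L0inf_val :> R -> R[i]^o;
  L0infP : L0inf_val \in L0inf_pred
}.

HB.instance Definition _ := [isSub for L0inf_val].
HB.instance Definition _ := [Choice of L0inf by <:].
HB.instance Definition _ := [SubChoice_isSubLmodule of L0inf by <:].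

Definition normw f : R := fine (ess_sup_itv `[0, +oo[ (wquot f)).

End L0inf.

Section dual.
Context {R : realType} (w : weight R).
Local Notation C := R[i].

Definition isdual (n : L0inf w -> C^o) :=
  linear n /\ exists M : R, forall f, normc (n f) <= M * normw w f.

Definition dual_pred : {pred L0inf w -> C^o} := mem [set n | isdual n].

Lemma dual_submod_closed : submod_closed dual_pred.
Proof.
split.
  rewrite inE; split; first by move=> a f g; rewrite scaler0 addr0.
  by exists 0 => f; rewrite normc0 mul0r.
move=> a m n; rewrite !inE => -[ml [M mM]] [nl [N nN]]; split.
  move=> b f g; rewrite !fctE ml nl !scalerDr !scalerA mulrC.
  by rewrite addrACA.
exists (normc a * M + N) => f; rewrite mulrDl -mulrA.
apply: le_trans (le_normcD _ _) (lerD _ (nN f)).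
by rewrite normcM ler_wpM2l//; case: (a) => ? ?; exact: sqrtr_ge0.
Qed.

HB.instance Definition _ :=
  GRing.isSubmodClosed.Build _ _ dual_pred dual_submod_closed.

Record dual : Type := mkdual {
  dual_val :> L0inf w -> C^o;
  dualP : dual_val \in dual_pred
}.

HB.instance Definition _ := [isSub for dual_val].
HB.instance Definition _ := [Choice of dual by <:].
HB.instance Definition _ := [SubChoice_isSubLmodule of dual by <:].
End dual.

Section arens_product.
Context {R : realType} (w : weight R).
Implicit Types (f : L0inf w) (m n u : dual w).

Definition conv (f phi : R -> R[i]) (x : R) : R[i] :=
  Cintegral `[0, +oo[ (fun y => f (x + y) * phi y).

(* [conv f phi] is in L0inf for f in L0inf and phi in L1, so that the default
   value 0 of [insubd] is never used; likewise for the default values in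
   [act] and [arens] below. *)
Definition L0inf_conv f (phi : R -> R[i]) : L0inf w := insubd 0 (conv f phi).

(* This determines the values of [act n f] up to almost everywhere equality on
   [0, +oo[, hence its image by an element of the dual. *)
Definition act n f : L0inf w :=
  xget 0 [set g : L0inf w | forall phi : R -> R[i], L1 w phi ->
    Cintegral `[0, +oo[ (fun x => g x * phi x) = n (L0inf_conv f phi)].

Definition arens m n : dual w := insubd 0 (fun f => m (act n f)).

Definition dual_norm m : R :=
  sup [set normc (m f) | f in [set f : L0inf w | normw w f <= 1]].

(* The dual has no two-sided unit in general; only the case 0 < k matters. *)
Definition arens_exp m (k : nat) : dual w := iterop k arens m 0.

Definition commutator m n : dual w := arens m n - arens n m.

Definition center : set (dual w) :=
  [set a | forall x, arens a x = arens x a].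

Definition right_identity : set (dual w) :=
  [set u | forall m, arens m u = m].

Definition Lambda : set (dual w) :=
  right_identity `&` [set u | dual_norm u = 1].

Definition right_ideal u : set (dual w) := range (arens u).

Definition is_homomorphism (theta : {linear dual w -> dual w}) :=
  forall m n, theta (arens m n) = arens (theta m) (theta n).

Definition is_isometric_isomorphism (theta : {linear dual w -> dual w}) :=
  [/\ is_homomorphism theta, bijective theta &
      forall m, dual_norm (theta m) = dual_norm m].

Definition is_derivation (theta D : {linear dual w -> dual w}) :=
  forall m n, D (arens m n) = arens (D m) (theta n) + arens (theta m) (D n).

Definition k_centralizing (k : nat) (D : {linear dual w -> dual w}) :=
  forall m, center (commutator (D m) (arens_exp m k)).

Definition k_commuting (k : nat) (D : {linear dual w -> dual w}) :=
  forall m, commutator (D m) (arens_exp m k) = 0.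

End arens_product.

(* Main.v *)
(* Write D = [0, +oo[ and g = f phi for f in L_0^oo(w) and phi the indicator of
   an interval.  Such a g is locally Lipschitz and g / w vanishes at infinity, so
   the kernel (x, y) |-> g (x + y) is a limit of finite rank kernels
   sum_i p_i(x) q_i(y), uniformly for the weight w(x) w(y); as it is symmetric,
   <a, b g> = <b, a g> for all a, b in A.  Hence every commutator of A is
   annihilated by left multiplications, x (a b - b a) = 0.

   The algebra A has a right identity u (a weak-star cluster point of the
   functions n 1_]0, 1/n]).  So if the commutator c = [D(m), m^k] is central then
   c = c u = u c = 0, which gives the equivalence.

   If theta is bijective and v is a right identity, then so is theta(v), and
   D(m) = D(m v) = D(m) + theta(m) D(v) shows that A D(v) = 0; as D is k-commuting
   D(v) = D(v) v = v D(v) = 0.  If A n = 0 then u + n is a right identity too, so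
   D(n) = 0; in particular D(v m - m v) = 0, that is D(m) = theta(v) D(m).  The
   last claims are the cases v = u and v = theta^-1(u).

   That the product is well defined amounts to L^1(w)^* = L^oo(1/w), which follows
   from the Radon-Nikodym theorem. *)
Require Import Defs.
From HB Require Import structures.
From mathcomp Require Import all_boot all_order all_algebra.
From mathcomp Require Import complex.
From mathcomp Require Import all_classical all_reals all_analysis.
From mathcomp Require Import measurable_realfun ess_sup_inf.
From mathcomp Require Import ring lra.

Set Implicit Arguments.
Unset Strict Implicit.
Unset Printing Implicit Defensive.

Import Order.TTheory GRing.Theory Num.Theory.
Import numFieldNormedType.Exports.
Import Normc.
Import Defs.
Import HBNNSimple.

Local Open Scope classical_set_scope.
Local Open Scope ring_scope.

(** * Complex integrals *)

(** [L0inf] consists of functions, and [act n f] is a chosen representative, determined only almost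
    everywhere. Identities between such elements are therefore tested by integrating over intervals
    []a, b]], and Lebesgue differentiation turns these integrals back into almost everywhere
    equalities or bounds. Interval indicators serve a second purpose. As [act c f] pairs with phi to
    give c(f phi), one has A c = 0 once c vanishes on all f phi with phi = 1_]s,t]. For such phi, f
    phi is z |-> int_(z+s)^(z+t) f, an integral over a moving window, and its increments are
    integrals over two short end pieces: this gives the Lipschitz bound although [f] is only
    measurable. Submultiplicativity of [w] makes the estimates uniform for the weight w(x) w(y). In
    the representation theorem Lebesgue measure on the half-line is infinite and 1_E need not lie in
    L^1(w). Radon-Nikodym is therefore applied to the finite charge E |-> F((e^-x / w) 1_E), and the
    density is then multiplied by w e^x. *)

Section complex_integral.
Context {R : realType}.
Local Notation mu := (@lebesgue_measure R).
Local Notation Re := (@complex.Re R).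
Local Notation Im := (@complex.Im R).
Implicit Types (D : set R) (f g : R -> R[i]) (v : R -> R).

Lemma normc_ge0 (z : R[i]) : 0 <= normc z.
Proof. by case: z => a b; exact: sqrtr_ge0. Qed.

Lemma normcZr (r : R) (z : R[i]) : normc (r%:C%C * z) = `|r| * normc z.
Proof. by rewrite normcM /= expr0n/= addr0 sqrtr_sqr. Qed.

Lemma normc_real (r : R) : normc r%:C%C = `|r|.
Proof. by rewrite /= expr0n/= addr0 sqrtr_sqr. Qed.

Lemma normcN (z : R[i]) : normc (- z) = normc z.
Proof. by case: z => a b; rewrite /= !sqrrN. Qed.

Lemma Re_le_normc (z : R[i]) : `|Re z| <= normc z.
Proof.
by case: z => a b /=; rewrite -sqrtr_sqr ler_wsqrtr// lerDl sqr_ge0.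
Qed.

Lemma Im_le_normc (z : R[i]) : `|Im z| <= normc z.
Proof.
by case: z => a b /=; rewrite -sqrtr_sqr ler_wsqrtr// lerDr sqr_ge0.
Qed.

Lemma normc_le_ReIm (z : R[i]) : normc z <= `|Re z| + `|Im z|.
Proof.
case: z => a b /=; rewrite -[leRHS]ger0_norm ?addr_ge0// -sqrtr_sqr.
by rewrite ler_wsqrtr// sqrrD !real_normK ?num_real// lerD2r lerDl mulrn_wge0// mulr_ge0.
Qed.

Lemma cmeasurable_funD D f g : measurable D -> cmeasurable_fun D f ->
  cmeasurable_fun D g -> cmeasurable_fun D (fun x => f x + g x).
Proof.
move=> mD [fr fi] [gr gi]; split.
  by rewrite (_ : (fun _ => _) = (Re \o f) \+ (Re \o g));
    [exact: measurable_funD | apply/funext => x /=; rewrite raddfD].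
by rewrite (_ : (fun _ => _) = (Im \o f) \+ (Im \o g));
  [exact: measurable_funD | apply/funext => x /=; rewrite raddfD].
Qed.

Lemma cmeasurable_funM D f g : measurable D -> cmeasurable_fun D f ->
  cmeasurable_fun D g -> cmeasurable_fun D (fun x => f x * g x).
Proof.
move=> mD [fr fi] [gr gi]; split.
  rewrite (_ : (fun _ => _) = (Re \o f) \* (Re \o g) \- (Im \o f) \* (Im \o g)).
    by apply: measurable_funB; exact: measurable_funM.
  by apply/funext => x /=; case: (f x) (g x) => [? ?] [? ?].
rewrite (_ : (fun _ => _) = (Re \o f) \* (Im \o g) \+ (Im \o f) \* (Re \o g)).
  by apply: measurable_funD; exact: measurable_funM.
by apply/funext => x /=; case: (f x) (g x) => [? ?] [? ?].
Qed.

Lemma cmeasurable_cst D (c : R[i]) : cmeasurable_fun D (fun=> c).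
Proof. by split; exact: measurable_cst. Qed.

Lemma cmeasurable_real D v : measurable_fun D v ->
  cmeasurable_fun D (fun x => (v x)%:C%C).
Proof. by move=> mv; split => //=; exact: measurable_cst. Qed.

Lemma cmeasurable_funS D E f : measurable D -> E `<=` D ->
  cmeasurable_fun D f -> cmeasurable_fun E f.
Proof. by move=> mD ED [fr fi]; split; exact: measurable_funS mD ED _. Qed.

Lemma measurable_normc D f : measurable D -> cmeasurable_fun D f ->
  measurable_fun D (@normc R \o f).
Proof.
move=> mD [fr fi].
rewrite (_ : @normc R \o f = (fun x => Num.sqrt (Re (f x) ^+ 2 + Im (f x) ^+ 2))).
  apply: measurableT_comp.
    by have := continuous_measurable_fun (@sqrt_continuous R).
  by apply: measurable_funD; exact: measurable_funX.
by apply/funext => x /=; case: (f x).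
Qed.

Lemma integrable_EFinD D (h k : R -> R) : measurable D ->
  mu.-integrable D (EFin \o h) -> mu.-integrable D (EFin \o k) ->
  mu.-integrable D (EFin \o (fun x => h x + k x)).
Proof. by move=> mD hI kI; have := @integrableD _ _ _ mu D mD _ _ hI kI. Qed.

Lemma integrable_EFinB D (h k : R -> R) : measurable D ->
  mu.-integrable D (EFin \o h) -> mu.-integrable D (EFin \o k) ->
  mu.-integrable D (EFin \o (fun x => h x - k x)).
Proof. by move=> mD hI kI; have := @integrableB _ _ _ mu D mD _ _ hI kI. Qed.

Lemma integrable_EFinZ D r (h : R -> R) : measurable D ->
  mu.-integrable D (EFin \o h) -> mu.-integrable D (EFin \o (fun x => r * h x)).
Proof. by move=> mD hI; have := @integrableZl _ _ _ mu D mD r _ hI. Qed.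

Definition cintegrable D f :=
  mu.-integrable D (EFin \o (Re \o f)) /\ mu.-integrable D (EFin \o (Im \o f)).

Lemma cintegrable_measurable D f : cintegrable D f -> cmeasurable_fun D f.
Proof.
by move=> [/measurable_int fr /measurable_int fi]; split; exact/measurable_EFinP.
Qed.

Lemma cintegrable_normc D f : measurable D -> cintegrable D f ->
  mu.-integrable D (EFin \o (@normc R \o f)).
Proof.
move=> mD fI; have [fr fi] := fI.
apply: (@le_integrable _ _ _ mu D mD _
  (EFin \o (fun x => `|Re (f x)| + `|Im (f x)|))).
- apply/measurable_EFinP.
  by have := measurable_normc mD (cintegrable_measurable fI).
- move=> x Dx /=; rewrite lee_fin ger0_norm ?normc_ge0//.
  by rewrite ger0_norm ?addr_ge0// normc_le_ReIm.
- by apply: integrable_EFinD => //; exact: integrable_norm.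
Qed.

Lemma le_cintegrable D f v : measurable D -> cmeasurable_fun D f ->
  mu.-integrable D (EFin \o v) -> {ae mu, forall x, D x -> normc (f x) <= v x} ->
  cintegrable D f.
Proof.
move=> mD [fr fi] vI fv.
have aux (h : R -> R) : measurable_fun D h ->
    (forall x, `|h x| <= normc (f x)) -> mu.-integrable D (EFin \o h).
  move=> mh hf; apply/integrableP; split; first exact/measurable_EFinP.
  have /integrableP[mv] := vI; apply: le_lt_trans.
  apply: ae_ge0_le_integral => //.
  - by do 2 apply: measurableT_comp => //.
  - by apply: measurableT_comp.
  - apply: (@filterS _ _ (ae_filter_ringOfSetsType mu) _ _ _ fv) => x vx Dx /=.
    rewrite lee_fin (le_trans (hf x))// (le_trans (vx Dx))//; exact: ler_norm.
by split; apply: aux => // x; [exact: Re_le_normc|exact: Im_le_normc].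
Qed.

Lemma cintegrableS D E f : measurable D -> measurable E -> E `<=` D ->
  cintegrable D f -> cintegrable E f.
Proof.
move=> mD mE ED [fr fi].
split.
  by have := @integrableS _ _ _ mu _ _ _ mD mE ED fr.
by have := @integrableS _ _ _ mu _ _ _ mD mE ED fi.
Qed.

Lemma cintegrableD D f g : measurable D -> cintegrable D f -> cintegrable D g ->
  cintegrable D (fun x => f x + g x).
Proof.
move=> mD [fr fi] [gr gi]; rewrite /cintegrable.
have -> : Re \o (fun x => f x + g x) = (fun x => Re (f x) + Re (g x)).
  by apply/funext => x /=; rewrite raddfD.
have -> : Im \o (fun x => f x + g x) = (fun x => Im (f x) + Im (g x)).
  by apply/funext => x /=; rewrite raddfD.
by split; exact: integrable_EFinD.
Qed.

Lemma cintegrableZ D f (c : R[i]) : measurable D -> cintegrable D f ->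
  cintegrable D (fun x => c * f x).
Proof.
move=> mD [fr fi]; rewrite /cintegrable.
have -> : Re \o (fun x => c * f x) = (fun x => Re c * Re (f x) - Im c * Im (f x)).
  by apply/funext => x /=; case: c (f x) => [? ?] [? ?].
have -> : Im \o (fun x => c * f x) = (fun x => Re c * Im (f x) + Im c * Re (f x)).
  by apply/funext => x /=; case: c (f x) => [? ?] [? ?].
split; first by apply: integrable_EFinB => //; exact: integrable_EFinZ.
by apply: integrable_EFinD => //; exact: integrable_EFinZ.
Qed.

Lemma cintegrableB D f g : measurable D -> cintegrable D f -> cintegrable D g ->
  cintegrable D (fun x => f x - g x).
Proof.
move=> mD fI gI.
under eq_fun do rewrite -mulN1r.
by apply: cintegrableD => //; exact: cintegrableZ.
Qed.

Lemma CintegralD D f g : measurable D -> cintegrable D f -> cintegrable D g ->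
  Cintegral D (fun x => f x + g x) = Cintegral D f + Cintegral D g.
Proof.
move=> mD [fr fi] [gr gi]; rewrite /Cintegral.
under eq_Rintegral do rewrite raddfD.
under [X in (_ +i* X)%C]eq_Rintegral do rewrite raddfD.
by rewrite !RintegralD.
Qed.

Lemma CintegralZ D f (c : R[i]) : measurable D -> cintegrable D f ->
  Cintegral D (fun x => c * f x) = c * Cintegral D f.
Proof.
move=> mD [fr fi]; rewrite /Cintegral.
rewrite (@eq_Rintegral _ _ _ mu D
  (fun x => Re c * Re (f x) - Im c * Im (f x))); last first.
  by move=> x _; case: c (f x) => [? ?] [? ?].
rewrite (@eq_Rintegral _ _ _ mu D
  (fun x => Re c * Im (f x) + Im c * Re (f x)) (fun x => Im _)); last first.
  by move=> x _; case: c (f x) => [? ?] [? ?].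
rewrite RintegralB//; try exact: integrable_EFinZ.
rewrite RintegralD//; try exact: integrable_EFinZ.
rewrite !RintegralZl//.
by case: c => a b; apply/eqP; rewrite eq_complex/= !eqxx.
Qed.

Lemma eq_Cintegral D f g : (forall x, D x -> f x = g x) ->
  Cintegral D f = Cintegral D g.
Proof.
move=> fg; rewrite /Cintegral.
under eq_Rintegral => x /set_mem Dx do rewrite fg//.
by under [X in (_ +i* X)%C]eq_Rintegral => x /set_mem Dx do rewrite fg//.
Qed.

(* With [z] the integral of [f], [|z|^2] is the integral of
   [Re z Re f + Im z Im f <= |z| |f|]. *)
Lemma normc_Cintegral D f : measurable D -> cintegrable D f ->
  normc (Cintegral D f) <= \int[mu]_(x in D) normc (f x).
Proof.
move=> mD fI; have [fr fi] := fI; set z := Cintegral D f.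
have [->|z0] := eqVneq z 0.
  by rewrite normc0 Rintegral_ge0// => x _; exact: normc_ge0.
have z_gt0 : 0 < normc z.
  rewrite lt_neqAle normc_ge0 andbT eq_sym.
  by apply: contra z0 => /eqP/eq0_normc ->.
rewrite -(ler_pM2l z_gt0) -RintegralZl//; last exact: cintegrable_normc.
have -> : normc z * normc z = Re z * Re z + Im z * Im z.
  by rewrite -expr2; case: (z) => a b /=; rewrite sqr_sqrtr ?addr_ge0 ?sqr_ge0.
rewrite {2 4}/z /= -!RintegralZl// -RintegralD//; try exact: integrable_EFinZ.
apply: le_Rintegral => //.
- by apply: integrable_EFinD => //; exact: integrable_EFinZ.
- by apply: integrable_EFinZ => //; exact: cintegrable_normc.
move=> x _.
have := Re_le_normc
  ((\int[mu]_(x0 in D) Re (f x0) -i* \int[mu]_(x0 in D) Im (f x0))%C * f x).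
rewrite normcM /= sqrrN; apply: le_trans; apply: le_trans (ler_norm _).
by case: (f x) => [c d] /=; rewrite mulNr opprK.
Qed.

Lemma CintegralB D f g : measurable D -> cintegrable D f -> cintegrable D g ->
  Cintegral D (fun x => f x - g x) = Cintegral D f - Cintegral D g.
Proof.
move=> mD fI gI; rewrite -[in RHS]mulN1r -CintegralZ// -CintegralD//.
  by apply: eq_Cintegral => x _; rewrite mulN1r.
exact: cintegrableZ.
Qed.

Lemma le_normc_Cintegral D f v : measurable D -> cmeasurable_fun D f ->
  mu.-integrable D (EFin \o v) -> (forall x, D x -> 0 <= v x) ->
  {ae mu, forall x, D x -> normc (f x) <= v x} ->
  normc (Cintegral D f) <= \int[mu]_(x in D) v x.
Proof.
move=> mD mf vI v0 fv.
have fI := le_cintegrable mD mf vI fv.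
have nI := cintegrable_normc mD fI.
apply: le_trans (normc_Cintegral mD fI) _.
apply: fine_le; [exact: integrable_fin_num|exact: integrable_fin_num|].
apply: ae_ge0_le_integral => //.
- by move=> x _; rewrite lee_fin normc_ge0.
- exact: measurable_int nI.
- exact: measurable_int vI.
Qed.

End complex_integral.

(** * Translations and the seminorm of L_0^oo(w) *)

Section translation.
Context {R : realType}.
Local Notation mu := (@lebesgue_measure R).

Lemma measurable_shift (c : R) : measurable_fun [set: R] (fun y : R => c + y).
Proof. exact: measurable_funD. Qed.

(** Translation invariance: the pushforward agrees with Lebesgue measure on the intervals []a, b]],
    and these values determine the measure. *)
Lemma pushforward_shift (c : R) (A : set R) : measurable A ->
  pushforward mu (fun y : measurableTypeR R => c + y : measurableTypeR R) A = mu A.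
Proof.
move=> mA; apply/esym.
have mc : measurable_fun [set: measurableTypeR R]
  (fun y : measurableTypeR R => c + y : measurableTypeR R) := measurable_shift c.
have := @lebesgue_measure_unique R
  (pushforward mu (fun y : measurableTypeR R => c + y : measurableTypeR R)).
apply => //= _ [[a b]] _ <-.
rewrite /pushforward /=.
have -> : (fun y : R => c + y) @^-1` `]a, b] = `](a - c), (b - c)]%classic.
  by apply/seteqP; split=> y /=; rewrite !in_itv/= lerBrDl ltrBlDl.
rewrite !lebesgue_measure_itv/= !lte_fin ltrD2r.
by case: ifP => // _; rewrite -!EFinD; congr (_%:E); ring.
Qed.

Lemma ae_shift (c : R) (P : R -> Prop) : {ae mu, forall z, P z} ->
  {ae mu, forall y, P (c + y)}.
Proof.
move=> [N [mN N0 PN]].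
exists ((fun y : R => c + y) @^-1` N); split.
- rewrite -[X in measurable X]setTI.
  by have := measurable_shift c measurableT mN.
- by have := pushforward_shift c mN; rewrite /pushforward => ->.
- by move=> y /= Py; apply: PN.
Qed.

Lemma RintegralT_shift (c : R) (f : R -> R) : measurable_fun [set: R] f ->
  mu.-integrable [set: R] (EFin \o (fun y => f (c + y))) ->
  \int[mu]_x f x = \int[mu]_y f (c + y).
Proof.
move=> mf fI.
have mc : measurable_fun [set: measurableTypeR R]
  (fun y : measurableTypeR R => c + y : measurableTypeR R) := measurable_shift c.
have mEf : measurable_fun [set: measurableTypeR R] (EFin \o f).
  by have /measurable_EFinP := mf.
congr fine; have := @integral_pushforward _ _ (measurableTypeR R) (measurableTypeR R)
  R _ mc mu [set: R] (EFin \o f) mEf.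
rewrite preimage_setT => <- //.
by apply: eq_measure_integral => A mA _; exact/esym/pushforward_shift.
Qed.

Lemma Rintegral_shift (c : R) (D : set R) (f : R -> R) : measurable D ->
  measurable_fun D f ->
  mu.-integrable ((fun y => c + y) @^-1` D) (EFin \o (fun y => f (c + y))) ->
  \int[mu]_(x in D) f x = \int[mu]_(y in (fun y => c + y) @^-1` D) f (c + y).
Proof.
move=> mD mf.
have mcD : measurable ((fun y : R => c + y) @^-1` D).
  by rewrite -[X in measurable X]setTI; have := measurable_shift c measurableT mD.
have E : (fun y => f (c + y)) \_ ((fun y => c + y) @^-1` D) = fun y => (f \_ D) (c + y).
  by apply/funext => y; rewrite !patchE.
move=> /(@integrable_mkcond _ _ _ mu _ _ mcD); rewrite restrict_EFin E => fI.
rewrite Rintegral_mkcond [RHS]Rintegral_mkcond E; apply: RintegralT_shift => //.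
by have /(measurable_restrictT f mD) := mf.
Qed.
End translation.

Section L0inf_theory.
Context {R : realType} (w : weight R).
Local Notation mu := (@lebesgue_measure R).
Local Notation DD := (`[0%R, +oo[%classic : set R).

(** [ess_sup_itv] is taken for a restricted measure; this turns its almost everywhere statements
    into implications for Lebesgue measure itself. *)
Lemma ae_mrestr_itv (i : interval R) (P : R -> Prop) :
  (\forall x \ae mrestr mu (measurable_itv i), P x) <->
  {ae mu, forall x, x \in i -> P x}.
Proof.
split.
  move=> [N [mN N0 PN]]; exists (N `&` [set` i]); split.
  - by apply: measurableI => //; exact: measurable_itv.
  - exact: N0.
  - move=> x /= /not_implyP[ix nPx]; split => //; exact: PN.
move=> [N [mN N0 PN]]; exists (N `|` ~` [set` i]); split.
- by apply: measurableU => //; apply: measurableC; exact: measurable_itv.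
- rewrite /= /mrestr setIUl setICl setU0.
  apply/eqP; rewrite eq_le measure_ge0 andbT -N0 le_measure ?inE//.
  by apply: measurableI => //; exact: measurable_itv.
- move=> x /= nPx; have [ix|] := boolP (x \in i); last by move=> /negP h; right.
  by left; apply: PN => /= /(_ ix).
Qed.

Lemma L0inf_cmeasurable (f : L0inf w) : cmeasurable_fun DD f.
Proof. by have := L0infP f; rewrite inE => -[]. Qed.

Lemma ess_sup_L0inf_fin_num (f : L0inf w) :
  ess_sup_itv `[0%R, +oo[ (wquot w f) \is a fin_num.
Proof.
rewrite ge0_fin_numE; first by have := L0infP f; rewrite inE => -[].
by apply: ess_sup_itv_ge0 => //; rewrite lebesgue_measure_itv/= ltry ltry.
Qed.

Lemma normw_ge0 (f : L0inf w) : 0 <= normw w f.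
Proof.
apply: fine_ge0; apply: ess_sup_itv_ge0 => //.
by rewrite lebesgue_measure_itv/= ltry ltry.
Qed.

Lemma ae_le_normw (f : L0inf w) :
  {ae mu, forall x, 0 <= x -> normc (f x) <= normw w f * w x}.
Proof.
have /ae_mrestr_itv := ess_sup_ge (mrestr mu (measurable_itv `[0%R, +oo[))
  (EFin \o wquot w f).
apply: (@filterS _ _ (ae_filter_ringOfSetsType mu)) => x /=.
rewrite in_itv/= andbT => + x0 => /(_ x0).
rewrite -[X in (_ <= X)%E](fineK (ess_sup_L0inf_fin_num f)) lee_fin /wquot.
by rewrite ler_pdivrMr ?weight_gt0.
Qed.

Lemma normw_le (f : L0inf w) (c : R) :
  {ae mu, forall x, 0 <= x -> normc (f x) <= c * w x} -> normw w f <= c.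
Proof.
move=> fc; rewrite -lee_fin fineK ?ess_sup_L0inf_fin_num//.
apply/ess_supP/ae_mrestr_itv.
apply: (@filterS _ _ (ae_filter_ringOfSetsType mu) _ _ _ fc) => x /=.
rewrite in_itv/= andbT => + x0 => /(_ x0) xc.
by rewrite lee_fin /wquot ler_pdivrMr ?weight_gt0.
Qed.

Lemma ae_le_tail (f : L0inf w) (e : R) : 0 < e -> exists2 X, 0 <= X &
  {ae mu, forall x, X < x -> normc (f x) <= e * w x}.
Proof.
move=> e0; have := L0infP f; rewrite inE => -[_ _].
move=> /fine_cvgP[ffin] /cvgrPdist_le /(_ _ e0) fe.
near +oo_R => X; exists X; first by near: X; exact: nbhs_pinfty_ge.
have : (ess_sup_itv `]X, +oo[ (wquot w f) <= e%:E)%E.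
  have Xfin : ess_sup_itv `]X, +oo[ (wquot w f) \is a fin_num by near: X.
  rewrite -(fineK Xfin) lee_fin (le_trans (ler_norm _))//.
  by rewrite -normrN -[X in `|X|]add0r; near: X.
move=> /ess_supP /ae_mrestr_itv.
apply: (@filterS _ _ (ae_filter_ringOfSetsType mu)) => x /=.
rewrite in_itv/= andbT => + Xx => /(_ Xx).
have x0 : 0 <= x.
  by rewrite (le_trans _ (ltW Xx))//; near: X; exact: nbhs_pinfty_ge.
by rewrite lee_fin /wquot ler_pdivrMr ?weight_gt0.
Unshelve. all: by end_near. Qed.

Lemma isL0infI (f : R -> R[i]) (c : R) : cmeasurable_fun DD f ->
  {ae mu, forall x, 0 <= x -> normc (f x) <= c * w x} ->
  (forall e, 0 < e -> exists X,
     {ae mu, forall x, 0 <= x -> X < x -> normc (f x) <= e * w x}) ->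
  isL0inf w f.
Proof.
move=> mf fc fe; split => //.
  apply: (@le_lt_trans _ _ c%:E); last exact: ltry.
  apply/ess_supP/ae_mrestr_itv.
  apply: (@filterS _ _ (ae_filter_ringOfSetsType mu) _ _ _ fc) => x /=.
  rewrite in_itv/= andbT => + x0 => /(_ x0) xc.
  by rewrite lee_fin /wquot ler_pdivrMr ?weight_gt0.
have le_e e : 0 < e -> \forall X \near +oo_R,
    (0 <= ess_sup_itv `]X, +oo[ (wquot w f) <= e%:E)%E.
  move=> /fe[X0 fX0]; near=> X.
  have X_ge0 : 0 <= X by near: X; exact: nbhs_pinfty_ge.
  apply/andP; split.
    apply: ess_sup_itv_ge0.
      by move=> y /=; rewrite !in_itv/= !andbT => /ltW; apply: le_trans.
    by rewrite lebesgue_measure_itv/= ltry addye.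
  apply/ess_supP/ae_mrestr_itv.
  apply: (@filterS _ _ (ae_filter_ringOfSetsType mu) _ _ _ fX0) => x /=.
  rewrite in_itv/= andbT => + Xx.
  have x0 : 0 <= x by rewrite (le_trans _ (ltW Xx)).
  move=> /(_ x0) xc.
  have X0x : X0 < x.
    by rewrite (le_lt_trans _ Xx)//; near: X; exact: nbhs_pinfty_ge.
  by rewrite lee_fin /wquot ler_pdivrMr ?weight_gt0// xc.
apply/fine_cvgP; split.
  near=> X; have /andP[X0 X1] : (0 <= ess_sup_itv `]X, +oo[ (wquot w f) <= 1%:E)%E.
    by near: X; exact: le_e.
  by rewrite ge0_fin_numE// (le_lt_trans X1) ?ltry.
apply/cvgrPdist_le => e e0; near=> X.
have /andP[X0 X1] : (0 <= ess_sup_itv `]X, +oo[ (wquot w f) <= e%:E)%E.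
  by near: X; exact: le_e.
rewrite sub0r normrN ger0_norm ?fine_ge0// -lee_fin fineK//.
by rewrite ge0_fin_numE// (le_lt_trans X1) ?ltry.
Unshelve. all: by end_near. Qed.

(** The constant is made positive so that tolerances such as [e / M] can be formed. *)
Lemma dual_bounded (m : dual w) : exists2 M, 0 < M &
  forall f, normc (m f) <= M * normw w f.
Proof.
have := dualP m; rewrite inE => -[_ [M mM]].
exists (Num.max M 1); first by rewrite lt_max ltr01 orbT.
by move=> f; apply: le_trans (mM f) _; rewrite ler_wpM2r ?normw_ge0// le_max lexx.
Qed.

Lemma dual_linear (m : dual w) (a : R[i]) (f g : L0inf w) :
  m (a *: f + g) = a * m f + m g.
Proof. by have := dualP m; rewrite inE => -[+ _] => ->. Qed.

Lemma dual0 (m : dual w) : m 0 = 0.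
Proof. by have := dual_linear m (-1) 0 0; rewrite scaler0 addr0 mulN1r addNr. Qed.

Lemma dualD (m : dual w) f g : m (f + g) = m f + m g.
Proof. by have := dual_linear m 1 f g; rewrite scale1r mul1r. Qed.

Lemma dualZ (m : dual w) a f : m (a *: f) = a * m f.
Proof. by have := dual_linear m a f 0; rewrite !addr0 dual0 addr0. Qed.

Lemma dualB (m : dual w) f g : m (f - g) = m f - m g.
Proof. by rewrite -scaleN1r dualD dualZ mulN1r. Qed.

Lemma dual_sum (m : dual w) (I : Type) (r : seq I) (F : I -> L0inf w) :
  m (\sum_(i <- r) F i) = \sum_(i <- r) m (F i).
Proof.
elim: r => [|i r IH]; first by rewrite !big_nil dual0.
by rewrite !big_cons dualD IH.
Qed.

Lemma L0inf_valD (f g : L0inf w) x : (f + g) x = f x + g x.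
Proof. by []. Qed.

Lemma L0inf_valZ a (f : L0inf w) x : (a *: f) x = a * f x.
Proof. by []. Qed.

Lemma L0inf_valB (f g : L0inf w) x : (f - g) x = f x - g x.
Proof. by []. Qed.

Lemma L0inf_val_sum (I : Type) (r : seq I) (F : I -> L0inf w) x :
  (\sum_(i <- r) F i) x = \sum_(i <- r) F i x.
Proof.
elim: r => [|i r IH]; first by rewrite !big_nil.
by rewrite !big_cons L0inf_valD IH.
Qed.

Lemma dual_ext (m n : dual w) : (forall f, m f = n f) -> m = n.
Proof. by move=> mn; apply/val_inj/funext => f; exact: mn. Qed.

(** The seminorm of [f - g] is zero, so boundedness forces [m (f - g) = 0]; functionals thus factor
    through classes. *)
Lemma dual_ae_eq (m : dual w) (f g : L0inf w) :
  {ae mu, forall x, 0 <= x -> f x = g x} -> m f = m g.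
Proof.
move=> fg; have [M M0 mM] := dual_bounded m.
have : normw w (f - g) <= 0.
  apply: normw_le; apply: (@filterS _ _ (ae_filter_ringOfSetsType mu) _ _ _ fg).
  by move=> x + x0 => /(_ x0) fgx; rewrite L0inf_valB fgx subrr normc0 mul0r.
move=> fg0; have := mM (f - g); rewrite dualB => /le_trans/(_ (ler_wpM2l (ltW M0) fg0)).
rewrite mulr0 => h; apply/eqP; rewrite -subr_eq0; apply/eqP/eq0_normc/le_anti.
by rewrite h normc_ge0.
Qed.

Lemma dual_eq_on (m : dual w) (f g : L0inf w) :
  (forall x, 0 <= x -> f x = g x) -> m f = m g.
Proof. by move=> fg; apply: dual_ae_eq; apply: aeW. Qed.

End L0inf_theory.

(** * L^1(w) and its action *)

Section measurability.
Context {R : realType}.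
Local Notation mu := (@lebesgue_measure R).
Local Notation DD := (`[0%R, +oo[%classic : set R).

(** Fubini-Tonelli applies to the positive and negative parts separately, and [fine] is measurable,
    so the sections of [k] may fail to be integrable. *)
Lemma measurable_Rintegral_snd (k : R * R -> R) : measurable_fun [set: R * R] k ->
  measurable_fun [set: R] (fun x => \int[mu]_y k (x, y)).
Proof.
move=> mk.
have mk' : measurable_fun [set: measurableTypeR R * measurableTypeR R] (EFin \o k).
  by have /measurable_EFinP := mk.
have mp := @measurable_fun_fubini_tonelli_F _ _ (measurableTypeR R) (measurableTypeR R) R mu
  ((EFin \o k)^\+)%E (measurable_funepos mk') (fun=> funepos_ge0 _ _).
have mn := @measurable_fun_fubini_tonelli_F _ _ (measurableTypeR R) (measurableTypeR R) R mu
  ((EFin \o k)^\-)%E (measurable_funeneg mk') (fun=> funeneg_ge0 _ _).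
have mpn := emeasurable_funB mp mn.
have : measurable_fun [set: R] (fun x => fine (\int[mu]_y (k (x, y))%:E)%E).
  apply: measurableT_comp; first exact: fine_measurable.
  rewrite [X in measurable_fun _ X](_ : _ =
    (fubini_F mu ((EFin \o k)^\+) \- fubini_F mu ((EFin \o k)^\-))%E).
    by have := mpn.
  apply: funext => x.
  rewrite [LHS](integralE mu) /fubini_F.
  by congr (_ - _)%E; apply: eq_integral => y _; rewrite ?funepos.unlock ?funeneg.unlock.
by [].
Qed.

Lemma cmeasurable_restrict (D : set R) (f : R -> R[i]) : measurable D ->
  cmeasurable_fun D f ->
  cmeasurable_fun [set: R] (fun x => if x \in D then f x else 0).
Proof.
move=> mD [/(measurable_restrictT _ mD).1 fr /(measurable_restrictT _ mD).1 fi].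
split.
  rewrite (_ : (fun _ => _) = (fun x => complex.Re (f x)) \_ D)//.
  by apply/funext => x; rewrite patchE; case: ifP.
rewrite (_ : (fun _ => _) = (fun x => complex.Im (f x)) \_ D)//.
by apply/funext => x; rewrite patchE; case: ifP.
Qed.

Lemma cmeasurable_shift (f : R -> R[i]) x : 0 <= x -> cmeasurable_fun DD f ->
  cmeasurable_fun DD (fun y => f (x + y)).
Proof.
move=> x0 [fr fi].
have sub : (fun y : R => x + y) @` DD `<=` DD.
  by move=> _ /= [y + <-]; rewrite !in_itv/= !andbT; exact: addr_ge0.
have ms : measurable_fun DD (fun y : R => x + y).
  exact: measurable_funS (measurable_shift x).
split.
  by have := measurable_comp (measurable_itv _) sub fr ms.
by have := measurable_comp (measurable_itv _) sub fi ms.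
Qed.

Lemma cmeasurable_conv (f phi : R -> R[i]) : cmeasurable_fun DD f ->
  cmeasurable_fun DD phi -> cmeasurable_fun DD (conv f phi).
Proof.
move=> /(cmeasurable_restrict (measurable_itv _))[fr fi].
move=> /(cmeasurable_restrict (measurable_itv _))[pr pi].
(* Extended by zero, both factors are measurable on the whole line, so the kernel is measurable on
   the plane; for nonnegative [x] and [y] the sum [x + y] stays where [f] is unchanged. *)
pose f' x := if x \in DD then f x else 0.
pose p' x := if x \in DD then phi x else 0.
have ma : measurable_fun [set: R * R] (fun z : R * R => z.1 + z.2).
  exact: measurable_funD.
have mfr : measurable_fun [set: R * R] (fun z : R * R => complex.Re (f' (z.1 + z.2))).
  by have := measurableT_comp fr ma.
have mfi : measurable_fun [set: R * R] (fun z : R * R => complex.Im (f' (z.1 + z.2))).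
  by have := measurableT_comp fi ma.
have mpr : measurable_fun [set: R * R] (fun z : R * R => complex.Re (p' z.2)).
  by have := measurableT_comp pr (@measurable_snd _ _ R R).
have mpi : measurable_fun [set: R * R] (fun z : R * R => complex.Im (p' z.2)).
  by have := measurableT_comp pi (@measurable_snd _ _ R R).
have m1 := measurable_Rintegral_snd
  (measurable_funB (measurable_funM mfr mpr) (measurable_funM mfi mpi)).
have m2 := measurable_Rintegral_snd
  (measurable_funD (measurable_funM mfr mpi) (measurable_funM mfi mpr)).
have inDD (x : R) : 0 <= x -> x \in DD by move=> x0; rewrite inE/= in_itv/= andbT.
split.
- apply: (eq_measurable_fun _ _ (measurable_funS measurableT (@subsetT _ DD) m1)).
  move=> x /set_mem; rewrite /= in_itv/= andbT => x0.
  rewrite /conv/= [RHS]Rintegral_mkcond; apply: eq_Rintegral => y _.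
  rewrite [RHS]patchE /= /p'; case: (boolP (y \in _)) => yD; last by rewrite /= !mulr0 subrr.
  have y0 : 0 <= y by move: yD; rewrite inE/= in_itv/= andbT.
  rewrite /f' (inDD _ (addr_ge0 x0 y0)).
  by case: (f _) (phi _) => [? ?] [? ?].
- apply: (eq_measurable_fun _ _ (measurable_funS measurableT (@subsetT _ DD) m2)).
  move=> x /set_mem; rewrite /= in_itv/= andbT => x0.
  rewrite /conv/= [RHS]Rintegral_mkcond; apply: eq_Rintegral => y _.
  rewrite [RHS]patchE /= /p'; case: (boolP (y \in _)) => yD; last by rewrite /= !mulr0 addr0.
  have y0 : 0 <= y by move: yD; rewrite inE/= in_itv/= andbT.
  rewrite /f' (inDD _ (addr_ge0 x0 y0)).
  by case: (f _) (phi _) => [? ?] [? ?].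
Qed.
End measurability.

Section L1_theory.
Context {R : realType} (w : weight R).
Local Notation mu := (@lebesgue_measure R).
Local Notation DD := (`[0%R, +oo[%classic : set R).
Implicit Types (f : L0inf w) (phi psi : R -> R[i]).

Definition normL1 phi : R := \int[mu]_(x in DD) (w x * normc (phi x)).

Lemma measurable_weight : measurable_fun DD w.
Proof.
apply: subspace_continuous_measurable_fun; first exact: measurable_itv.
exact: weight_continuous.
Qed.

Lemma weight_ge0 x : 0 <= x -> 0 <= w x.
Proof. by move=> x0; exact/ltW/weight_gt0. Qed.

Lemma normL1_ge0 phi : 0 <= normL1 phi.
Proof.
apply: Rintegral_ge0 => x; rewrite /= in_itv/= andbT => x0.
by rewrite mulr_ge0 ?weight_ge0 ?normc_ge0.
Qed.

Lemma L1P phi : L1 w phi <-> cmeasurable_fun DD phi /\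
  mu.-integrable DD (EFin \o (fun x => w x * normc (phi x))).
Proof.
have E : (\int[mu]_(x in DD) `|(w x * normc (phi x))%:E| =
    \int[mu]_(x in DD) (w x * normc (phi x))%:E)%E.
  apply: eq_integral => x /set_mem; rewrite /= in_itv/= andbT => x0.
  by congr (_%:E); rewrite ger0_norm// mulr_ge0 ?weight_ge0 ?normc_ge0.
split=> -[mphi phiI]; split => //.
  apply/integrableP; split; last by rewrite /= E.
  apply/measurable_EFinP.
  by have := measurable_funM measurable_weight (measurable_normc (measurable_itv _) mphi).
by have /integrableP[_] := phiI; rewrite /= E.
Qed.

Lemma L1I phi (v : R -> R) : cmeasurable_fun DD phi ->
  mu.-integrable DD (EFin \o v) ->
  (forall x, 0 <= x -> w x * normc (phi x) <= v x) -> L1 w phi.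
Proof.
move=> mphi vI le_v; apply/L1P; split => //.
apply: le_integrable vI => //.
  apply/measurable_EFinP.
  by have := measurable_funM measurable_weight (measurable_normc (measurable_itv _) mphi).
move=> x; rewrite /= in_itv/= andbT => x0; rewrite lee_fin.
rewrite ger0_norm; first by rewrite (le_trans (le_v _ x0))// ler_norm.
by rewrite mulr_ge0 ?weight_ge0 ?normc_ge0.
Qed.

Lemma L1_linear a phi psi : L1 w phi -> L1 w psi ->
  L1 w (fun x => a * phi x + psi x).
Proof.
move=> /L1P[mphi phiI] /L1P[mpsi psiI].
apply: (@L1I _ (fun x => normc a * (w x * normc (phi x)) + w x * normc (psi x))).
- apply: cmeasurable_funD => //.
  by apply: cmeasurable_funM => //; exact: cmeasurable_cst.
- apply: integrable_EFinD => //; apply: integrable_EFinZ => //.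
- move=> x x0; rewrite mulrCA -normcM -mulrDr ler_wpM2l ?weight_ge0//.
  exact: le_normcD.
Qed.

Lemma L1Z a phi : L1 w phi -> L1 w (fun x => a * phi x).
Proof.
move=> phi1; have := L1_linear a phi1 (L1_linear (-1) phi1 phi1).
rewrite (_ : (fun x => _) = (fun x => a * phi x))//.
by apply/funext => x; rewrite mulN1r addNr addr0.
Qed.

Lemma L1D phi psi : L1 w phi -> L1 w psi -> L1 w (fun x => phi x + psi x).
Proof.
move=> phi1 psi1; have := L1_linear 1 phi1 psi1.
by under eq_fun do rewrite mul1r.
Qed.

Lemma L1B phi psi : L1 w phi -> L1 w psi -> L1 w (fun x => phi x - psi x).
Proof.
move=> phi1 psi1; have := L1_linear (-1) psi1 phi1.
by under eq_fun do rewrite mulN1r addrC.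
Qed.

(** [P] localises the bound on [f]: it is [True] for the global estimate and [X < z] for decay.
    Points where [phi] vanishes are exempt, so for an indicator only its support matters.
    Submultiplicativity splits the weight at [x + y]. *)
Lemma conv_bound (f : R -> R[i]) phi (P : R -> Prop) (x c : R) :
  cmeasurable_fun DD f -> L1 w phi -> 0 <= x -> 0 <= c ->
  {ae mu, forall z, 0 <= z -> P z -> normc (f z) <= c * w z} ->
  (forall y, 0 <= y -> phi y != 0 -> P (x + y)) ->
  cintegrable DD (fun y => f (x + y) * phi y) /\
  normc (conv f phi x) <= c * w x * normL1 phi.
Proof.
move=> mf /L1P[mphi phiI] x0 c0 fP phiP.
have mfp : cmeasurable_fun DD (fun y => f (x + y) * phi y).
  apply: cmeasurable_funM => //.
  exact: cmeasurable_shift.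
have vI : mu.-integrable DD (EFin \o (fun y => c * w x * (w y * normc (phi y)))).
  by apply: integrable_EFinZ => //; exact: measurable_itv.
have fv : {ae mu, forall y, DD y ->
    normc (f (x + y) * phi y) <= c * w x * (w y * normc (phi y))}.
  apply: (@filterS _ _ (ae_filter_ringOfSetsType mu) _ _ _ (ae_shift x fP)) => y.
  rewrite /= in_itv/= andbT => fy y0; rewrite normcM mulrA.
  have [->|phi0] := eqVneq (phi y) 0; first by rewrite normc0 !mulr0.
  rewrite ler_wpM2r ?normc_ge0// (le_trans (fy _ _))//.
  - exact: addr_ge0.
  - exact: phiP.
  - by rewrite -mulrA ler_wpM2l// weight_submul.
split; first by apply: le_cintegrable vI fv => //; exact: measurable_itv.
rewrite -RintegralZl//; apply: le_normc_Cintegral => //.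
by move=> y; rewrite /= in_itv/= andbT => y0; rewrite !mulr_ge0 ?weight_ge0 ?normc_ge0.
Qed.

Lemma conv_normw f phi x : L1 w phi -> 0 <= x ->
  cintegrable DD (fun y => f (x + y) * phi y) /\
  normc (conv f phi x) <= normw w f * w x * normL1 phi.
Proof.
move=> phi1 x0; apply: (@conv_bound _ _ (fun=> True)) => //.
- exact: L0inf_cmeasurable.
- exact: normw_ge0.
- by apply: (@filterS _ _ (ae_filter_ringOfSetsType mu) _ _ _ (ae_le_normw f)) => z + z0 _; exact.
Qed.

Lemma conv_tail f phi e : L1 w phi -> 0 < e -> exists2 X, 0 <= X &
  forall x, X <= x -> normc (conv f phi x) <= e * w x.
Proof.
(* The added 1 keeps the denominator positive when [phi] has norm zero. *)
move=> phi1 e0; pose d := e / (normL1 phi + 1).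
have n1 : 0 < normL1 phi + 1 by rewrite ltr_wpDl ?normL1_ge0.
have d0 : 0 < d by rewrite divr_gt0.
(* With [X + 1] the inequality [X < x + y] is strict even for [y = 0]. *)
have [X X0 fX] := ae_le_tail f d0; exists (X + 1); first by rewrite addr_ge0.
move=> x Xx; have x0 : 0 <= x by rewrite (le_trans _ Xx) ?addr_ge0.
have [|//|_ ] := @conv_bound f phi (fun z => X < z) x d (L0inf_cmeasurable f) phi1 x0 (ltW d0).
- by apply: (@filterS _ _ (ae_filter_ringOfSetsType mu) _ _ _ fX) => z + z0; exact.
- move=> y y0 _; rewrite (lt_le_trans _ (lerD Xx y0))// addr0 ltrDl//.
move=> /le_trans; apply; rewrite mulrAC ler_wpM2r ?weight_ge0//.
by rewrite /d mulrAC ler_pdivrMr// ler_wpM2l ?(ltW e0)// lerDl.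
Qed.

Lemma conv_isL0inf f phi : L1 w phi -> isL0inf w (conv f phi).
Proof.
move=> phi1; apply: (@isL0infI _ _ _ (normw w f * normL1 phi)).
- by apply: cmeasurable_conv; [exact: L0inf_cmeasurable|have [] := phi1].
- by apply: aeW => x x0; rewrite mulrAC; exact: (conv_normw f phi1 x0).2.
- move=> e e0; have [X X0 fX] := conv_tail f phi1 e0; exists X.
  by apply: aeW => x x0 /ltW; exact: fX.
Qed.

Lemma L0inf_convE phi (phi1 : L1 w phi) f x : L0inf_conv f phi x = conv f phi x.
Proof.
rewrite /L0inf_conv -[L0inf_val _]/(val _) val_insubd.
by rewrite (_ : conv f phi \in _)// inE; exact: conv_isL0inf.
Qed.

Lemma normw_conv f phi : L1 w phi ->
  normw w (L0inf_conv f phi) <= normw w f * normL1 phi.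
Proof.
move=> phi1; apply: normw_le; apply: aeW => x x0.
by rewrite (L0inf_convE phi1) mulrAC; exact: (conv_normw f phi1 x0).2.
Qed.

Opaque L0inf_conv.

Lemma conv_linearl a f g phi x : L1 w phi -> 0 <= x ->
  conv (a *: f + g) phi x = a * conv f phi x + conv g phi x.
Proof.
move=> phi1 x0; have [fI _] := conv_normw f phi1 x0.
have [gI _] := conv_normw g phi1 x0.
rewrite /conv -CintegralZ ?measurable_itv// -CintegralD ?measurable_itv//.
  by apply: eq_Cintegral => y _; rewrite L0inf_valD L0inf_valZ mulrDl mulrA.
by apply: cintegrableZ => //; exact: measurable_itv.
Qed.

Lemma conv_linearr a f phi psi x : L1 w phi -> L1 w psi -> 0 <= x ->
  conv f (fun y => a * phi y + psi y) x = a * conv f phi x + conv f psi x.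
Proof.
move=> phi1 psi1 x0; have [fI _] := conv_normw f phi1 x0.
have [gI _] := conv_normw f psi1 x0.
rewrite /conv -CintegralZ ?measurable_itv// -CintegralD ?measurable_itv//.
  by apply: eq_Cintegral => y _; rewrite mulrDr mulrCA.
by apply: cintegrableZ => //; exact: measurable_itv.
Qed.

Lemma dual_conv_linearl (n : dual w) a f g phi : L1 w phi ->
  n (L0inf_conv (a *: f + g) phi) =
  a * n (L0inf_conv f phi) + n (L0inf_conv g phi).
Proof.
move=> phi1; rewrite -dual_linear; apply: dual_eq_on => x x0.
by have := conv_linearl a f g phi1 x0; rewrite -!(L0inf_convE phi1).
Qed.

Lemma dual_conv_linearr (n : dual w) a f phi psi : L1 w phi -> L1 w psi ->
  n (L0inf_conv f (fun y => a * phi y + psi y)) =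
  a * n (L0inf_conv f phi) + n (L0inf_conv f psi).
Proof.
move=> phi1 psi1; rewrite -dual_linear; apply: dual_eq_on => x x0.
have := conv_linearr a f phi1 psi1 x0.
by rewrite -(L0inf_convE (L1_linear a phi1 psi1)) -(L0inf_convE phi1) -(L0inf_convE psi1).
Qed.

Lemma dual_conv_normw (n : dual w) : exists2 M, 0 < M & forall f phi, L1 w phi ->
  normc (n (L0inf_conv f phi)) <= M * normw w f * normL1 phi.
Proof.
have [M M0 nM] := dual_bounded n; exists M => // f phi phi1.
apply: le_trans (nM _) _; rewrite -mulrA ler_wpM2l ?(ltW M0)//.
exact: normw_conv.
Qed.

End L1_theory.

(** * Lebesgue differentiation *)

Section lebesgue_differentiation_itv.
Context {R : realType}.
Local Notation mu := (@lebesgue_measure R).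

(** One-sided, so that the averages at a point [x > X] only involve points to the right of [X]. *)
Definition right_itv (x : R) (n : nat) : set R := `]x, (x + n.+1%:R^-1)]%classic.

Lemma right_itv_measure x n : mu (right_itv x n) = (n.+1%:R^-1)%:E.
Proof.
rewrite /right_itv lebesgue_measure_itv/= lte_fin ltrDl invr_gt0 ltr0n/=.
by rewrite -EFinD addrAC subrr add0r.
Qed.

Lemma nicely_shrinking_right_itv x : nicely_shrinking x (right_itv x).
Proof.
split=> [n|]; first exact: measurable_itv.
have h0 n : 0 < 2 * n.+1%:R^-1 :> R by rewrite mulr_gt0// invr_gt0.
(* The ball of radius 2/(n+1) about [x] contains the interval and has length 4/(n+1), four times
   that of the interval. *)
exists (4, fun n => PosNum (h0 n)); split => //=.
- rewrite -[X in _ --> X](mulr0 2); apply: cvgMr; exact: cvg_harmonic.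
- move=> n y; rewrite /right_itv/= in_itv/= /ball/= => /andP[xy yx].
  rewrite ltr_distlC; apply/andP; split.
    by rewrite (lt_trans _ xy)// ltrBlDr ltrDl.
  rewrite (le_lt_trans yx)// ltrD2l ltr_pMl ?invr_gt0// ltr1n//.
- move=> n; rewrite right_itv_measure lebesgue_measure_ball ?(ltW (h0 n))//.
have E : 2 * n.+1%:R^-1 *+ 2 = 4 * n.+1%:R^-1 :> R by ring.
  by rewrite -EFinM lee_fin /= E.
Qed.

Lemma cvg_right_itv_average (h : R -> R) : locally_integrable setT h ->
  {ae mu, forall x, n.+1%:R * \int[mu]_(y in right_itv x n) h y @[n --> \oo] --> h x}.
Proof.
move=> hI; have := lebesgue_differentiation hI.
apply: (@filterS _ _ (ae_filter_ringOfSetsType mu)) => x hx.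
have := nice_lebesgue_differentiation nicely_shrinking_right_itv hI hx.
move=> /fine_cvgP[_]; apply: cvg_trans; apply: near_eq_cvg; near=> n.
rewrite /= right_itv_measure inver gt_eqF ?invr_gt0// invrK fineM//.
have : mu.-integrable (right_itv x n) (EFin \o h).
  have [mh _ hK] := hI; apply/integrableP; split.
    by apply/measurable_EFinP; exact: measurable_funS mh.
  apply: le_lt_trans (hK `[x, (x + n.+1%:R^-1)]%classic _ _) => //; last exact: segment_compact.
  apply: ge0_subset_integral => //; first exact: measurable_itv.
  - apply: measurableT_comp => //; apply/measurable_EFinP; exact: measurable_funS mh.
  - by move=> y; rewrite /right_itv /= !in_itv/= => /andP[/ltW -> ->].
by move=> hn; apply: integrable_fin_num => //; exact: measurable_itv.
Unshelve. all: by end_near. Qed.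

(** The averages of [h1], [h2] and [v] over [right_itv x n] converge almost everywhere; the interval
    inequality, multiplied by n+1, passes to the limit because the modulus is continuous. *)
Lemma ae_normc_le_itv (h1 h2 v : R -> R) (X : R) :
  locally_integrable setT h1 -> locally_integrable setT h2 ->
  locally_integrable setT v ->
  (forall x y, X < x -> x < y ->
    normc (\int[mu]_(t in `]x, y]) h1 t +i* \int[mu]_(t in `]x, y]) h2 t)%C <=
    \int[mu]_(t in `]x, y]) v t) ->
  {ae mu, forall x, X < x -> normc (h1 x +i* h2 x)%C <= v x}.
Proof.
move=> h1I h2I vI hv.
apply: (@filterS3 _ _ (ae_filter_ringOfSetsType mu) _ _ _ _ _ (cvg_right_itv_average h1I)
  (cvg_right_itv_average h2I) (cvg_right_itv_average vI)) => x h1x h2x xv Xx.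
have hn : normc (n.+1%:R * (\int[mu]_(y in right_itv x n) h1 y) +i*
    (n.+1%:R * \int[mu]_(y in right_itv x n) h2 y))%C @[n --> \oo] -->
    normc (h1 x +i* h2 x)%C.
  rewrite /=; apply: (@continuous_cvg _ _ _ _ _ _ (@Num.sqrt R)).
    exact: sqrt_continuous.
  by apply: cvgD; [exact: (cvgM h1x h1x)|exact: (cvgM h2x h2x)].
apply: (ler_cvg_to hn xv); near=> n.
rewrite (_ : (_ +i* _)%C = (n.+1%:R)%:C%C * ((\int[mu]_(y in right_itv x n) h1 y) +i*
    (\int[mu]_(y in right_itv x n) h2 y))%C); last first.
  by apply/eqP; rewrite eq_complex/= !mul0r subr0 addr0 !eqxx.
rewrite normcZr ger0_norm// ler_wpM2l//; apply: hv => //.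
by rewrite ltrDl invr_gt0.
Unshelve. all: by end_near. Qed.

End lebesgue_differentiation_itv.

(** * Bounds and equalities recovered from integrals over intervals *)

Section uniqueness.
Context {R : realType} (w : weight R).
Local Notation mu := (@lebesgue_measure R).
Local Notation DD := (`[0%R, +oo[%classic : set R).
Implicit Types (f : L0inf w) (phi psi : R -> R[i]).

Lemma weight_bounded (N : R) : exists2 W, 0 < W &
  forall x, 0 <= x -> x <= N -> w x <= W.
Proof.
have [N0|N0] := leP 0 N; last first.
  by exists 1 => // x x0 xN; have := le_lt_trans (le_trans x0 xN) N0; rewrite ltxx.
have cw : {within `[0, N], continuous w}.
  apply: continuous_subspaceW (weight_continuous (w := w)).
  by move=> x /=; rewrite !in_itv/= => /andP[->].
have [c cN wc] := EVT_max N0 cw.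
exists (w c) => [|x x0 xN].
  by apply: weight_gt0; move: cN; rewrite in_itv/= => /andP[].
by apply: wc; rewrite in_itv/= x0.
Qed.

(** Nothing is known of [w] at negative reals, hence the extension by zero; it is bounded on compact
    sets. *)
Lemma weight_locally_integrable : locally_integrable setT (w \_ DD).
Proof.
split; last 2 first.
- exact: openT.
- move=> K _ cK.
  have [N [_ KN]] := compact_bounded cK.
  have [W W0 wW] := weight_bounded (N + 1).
  apply: (@le_lt_trans _ _ (\int[mu]_(x in K) (cst W%:E) x)%E).
    apply: ge0_le_integral => //.
    - exact: compact_measurable.
    - apply/measurable_EFinP; apply: measurableT_comp => //.
      apply: measurable_funTS.
      by have /(measurable_restrictT w (measurable_itv _)) := @measurable_weight R w.
    - move=> x Kx; rewrite lee_fin patchE; case: ifPn => [|_]; last by rewrite normr0 ltW.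
      rewrite inE/= in_itv/= andbT => x0; rewrite ger0_norm ?weight_ge0// wW//.
      by apply: le_trans (ler_norm _) _; apply: KN => //; rewrite ltrDl.
  rewrite integral_cst; last exact: compact_measurable.
  by rewrite lte_mul_pinfty ?lee_fin ?ltW//; exact: compact_finite_measure.
- by have /(measurable_restrictT w (measurable_itv _)) := @measurable_weight R w.
Qed.

Lemma locally_integrable_le (h : R -> R) c : measurable_fun DD h -> 0 <= c ->
  {ae mu, forall x, 0 <= x -> `|h x| <= c * w x} ->
  locally_integrable setT (h \_ DD).
Proof.
move=> mh c0 hc; have [mw _ wK] := weight_locally_integrable.
have mhT : measurable_fun [set: R] (h \_ DD).
  by have /(measurable_restrictT h (measurable_itv _)) := mh.
split => //; first exact: openT.
move=> K KT cK; have mK := compact_measurable cK.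
apply: (@le_lt_trans _ _ (\int[mu]_(x in K) (c%:E * `|(w \_ DD) x|%:E))%E).
  apply: ae_ge0_le_integral => //.
  - apply/measurable_EFinP; apply: measurableT_comp => //.
    exact: measurable_funTS.
  - by move=> x _; rewrite mule_ge0// lee_fin.
  - apply: measurable_funeM; apply/measurable_EFinP; apply: measurableT_comp => //.
    exact: measurable_funTS.
  - apply: (@filterS _ _ (ae_filter_ringOfSetsType mu) _ _ _ hc) => x hx _.
    rewrite !patchE; case: ifPn => [|_]; last by rewrite normr0 mule0.
    rewrite inE/= in_itv/= andbT => x0; rewrite -EFinM lee_fin.
    by rewrite [in leRHS]ger0_norm ?weight_ge0// hx.
rewrite ge0_integralZl//; first by rewrite lte_mul_pinfty// wK.
apply/measurable_EFinP; apply: measurableT_comp => //.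
exact: measurable_funTS.
Qed.

Lemma integrable_patch (D E : set R) (v : R -> R) : measurable D -> measurable E ->
  mu.-integrable E (EFin \o v) -> mu.-integrable D (EFin \o (v \_ E)).
Proof.
move=> mD mE /(@integrable_mkcond _ _ _ mu _ _ mE); rewrite restrict_EFin => vI.
by apply: integrableS vI.
Qed.

Definition cindic (E : set R) (x : R) : R[i] := (\1_E x)%:C%C.

Lemma cindicE (E : set R) x : cindic E x = if x \in E then 1 else 0.
Proof. by rewrite /cindic indicE; case: ifP. Qed.

Lemma cmeasurable_cindic (D E : set R) : measurable E -> cmeasurable_fun D (cindic E).
Proof. by move=> mE; apply: cmeasurable_real; apply: measurable_funTS; exact: measurable_indic. Qed.

Lemma Cintegral_cindic (D E : set R) (h : R -> R[i]) : E `<=` D ->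
  Cintegral D (fun x => h x * cindic E x) = Cintegral E h.
Proof.
move=> ED; have DE : D `&` E = E by rewrite setIC; apply/setIidPl.
rewrite /Cintegral -{3 4}DE !Rintegral_mkcondr; congr (_ +i* _)%C; apply: eq_Rintegral => x _.
  by rewrite cindicE patchE; case: ifPn => xE; rewrite ?mulr1 ?mulr0.
by rewrite cindicE patchE; case: ifPn => xE; rewrite ?mulr1 ?mulr0.
Qed.

Lemma sub_itv_DD (a b : R) : 0 <= a -> `]a, b]%classic `<=` DD.
Proof.
move=> a0 x /=; rewrite !in_itv/= andbT => /andP[ax _].
by rewrite (le_trans a0)// ltW.
Qed.

Lemma weight_integrable_itv (a b : R) : 0 <= a -> mu.-integrable `]a, b] (EFin \o w).
Proof.
move=> a0; have [W W0 wW] := weight_bounded b.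
apply: measurable_bounded_integrable.
- exact: measurable_itv.
- have := @lebesgue_measure_itv R `]a, b]; rewrite /= => ->.
  by case: ifP => // _; rewrite -EFinD ltry.
- apply: measurable_funS (@measurable_weight R w) => //; exact: sub_itv_DD.
- exists W; split; first exact: num_real.
  move=> M WM x /=; rewrite in_itv/= => /andP[ax xb].
  have x0 : 0 <= x by rewrite (le_trans a0)// ltW.
  by rewrite ger0_norm ?weight_ge0// (le_trans (wW _ x0 xb))// ltW.
Qed.

Lemma L1_cindic_itv (a b : R) : 0 <= a -> L1 w (cindic `]a, b]) /\
  normL1 w (cindic `]a, b]) = \int[mu]_(x in `]a, b]) w x.
Proof.
move=> a0.
have E : (fun x => w x * normc (cindic `]a, b] x)) = (w : R -> R) \_ `]a, b].
  apply/funext => x; rewrite cindicE patchE; case: ifP => _; last by rewrite normc0 mulr0.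
  by rewrite normc1 mulr1.
split.
  apply/L1P; split; first exact: cmeasurable_cindic.
  by rewrite E; apply: integrable_patch => //; exact: weight_integrable_itv.
rewrite /normL1 E -Rintegral_mkcondr setIidr//; exact: sub_itv_DD.
Qed.

Lemma ae_neq (a : R) : {ae mu, forall x, x != a}.
Proof.
exists [set a]; split => //; first exact: lebesgue_measure_set1.
by move=> x /= /negP; rewrite negbK => /eqP.
Qed.

Lemma ae_ge0_gt0 (P : R -> Prop) :
  {ae mu, forall x, 0 < x -> P x} -> {ae mu, forall x, 0 <= x -> P x}.
Proof.
move=> aeP; apply: (@filterS2 _ _ (ae_filter_ringOfSetsType mu) _ _ _ _ aeP (ae_neq 0)).
by move=> x Px xn0 x0; apply: Px; rewrite lt_neqAle eq_sym xn0.
Qed.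

(** Lebesgue differentiation of both sides. The a priori constant [d] provides local integrability;
    the bound that comes out keeps the constant [c] of the interval inequality. *)
Lemma ae_normc_le_weight (g : R -> R[i]) d c X : cmeasurable_fun DD g ->
  {ae mu, forall x, 0 <= x -> normc (g x) <= d * w x} -> 0 <= X ->
  (forall a b, X < a -> a < b ->
    normc (Cintegral `]a, b] g) <= c * \int[mu]_(x in `]a, b]) w x) ->
  {ae mu, forall x, X < x -> normc (g x) <= c * w x}.
Proof.
move=> [mr mi] gd X0 gc.
have ld (h : R -> R) : measurable_fun DD h -> (forall x, `|h x| <= normc (g x)) ->
    locally_integrable setT (h \_ DD).
  move=> mh hg; apply: (@locally_integrable_le _ `|d|) => //.
  apply: (@filterS _ _ (ae_filter_ringOfSetsType mu) _ _ _ gd) => x gx x0.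
  rewrite (le_trans (hg x))// (le_trans (gx x0))//.
  by rewrite ler_wpM2r ?weight_ge0// ler_norm.
have cw : locally_integrable setT ((fun x => c * w x) \_ DD).
  apply: (@locally_integrable_le _ `|c|) => //.
    by apply: measurable_funM => //; exact: measurable_weight.
  by apply: aeW => x x0; rewrite normrM [`|w x|]ger0_norm ?weight_ge0.
have E (h : R -> R) a b : 0 <= a ->
    \int[mu]_(t in `]a, b]) (h \_ DD) t = \int[mu]_(t in `]a, b]) h t.
  move=> a0; apply: eq_Rintegral => x /set_mem /(sub_itv_DD a0) Dx.
  by rewrite patchE mem_set.
have := ae_normc_le_itv (X := X) (ld _ mr (fun x => Re_le_normc (g x)))
  (ld _ mi (fun x => Im_le_normc (g x))) cw.
move=> H; have {}H := H _; apply: (@filterS _ _ (ae_filter_ringOfSetsType mu) _ _ _ (H _)).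
  move=> x /[swap] Xx /(_ Xx).
  have xD : x \in DD by rewrite inE/= in_itv/= andbT (le_trans X0)// ltW.
  by rewrite !patchE xD; case: (g x).
move=> a b Xa ab; have a0 : 0 <= a by rewrite (le_trans X0)// ltW.
by rewrite !E// RintegralZl//; [exact: gc|exact: weight_integrable_itv].
Qed.

(** Intervals inside []0, +oo[] suffice, the point 0 being negligible. *)
Lemma normw_le_itv f c : (forall a b, 0 < a -> a < b ->
    normc (Cintegral `]a, b] f) <= c * \int[mu]_(x in `]a, b]) w x) ->
  normw w f <= c.
Proof.
move=> fc; apply/normw_le/ae_ge0_gt0.
exact: ae_normc_le_weight (L0inf_cmeasurable f) (ae_le_normw f) (lexx 0) fc.
Qed.

Lemma cintegrable_mul_L1 f phi : L1 w phi -> cintegrable DD (fun x => f x * phi x).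
Proof.
move=> phi1; have [+ _] := conv_normw f phi1 (lexx 0).
rewrite (_ : (fun y => f (0 + y) * phi y) = (fun x => f x * phi x))//.
by apply/funext => y; rewrite add0r.
Qed.

(** One inequality of the isometry between L^oo(1/w) and the dual of L^1(w), obtained by testing on
    indicators of intervals, whose norm is the integral of [w]. *)
Lemma normw_le_L1 f c : (forall phi, L1 w phi ->
    normc (Cintegral DD (fun x => f x * phi x)) <= c * normL1 w phi) ->
  normw w f <= c.
Proof.
move=> fc; apply: normw_le_itv => a b a0 ab.
have [phi1 <-] := L1_cindic_itv b (ltW a0).
rewrite -(Cintegral_cindic f (sub_itv_DD (ltW a0))); exact: fc.
Qed.

(** The difference integrates to zero over every interval, so [normw_le_itv] applies to it with
    constant 0. *)
Lemma L0inf_ae_eq_itv (f g : L0inf w) : (forall a b, 0 < a -> a < b ->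
    Cintegral `]a, b] f = Cintegral `]a, b] g) ->
  {ae mu, forall x, 0 <= x -> f x = g x}.
Proof.
move=> fg; have fg0 : normw w (f - g) <= 0.
  apply: normw_le_itv => a b a0 ab; rewrite mul0r.
  have aD := @sub_itv_DD a b (ltW a0).
  have [phi1 _] := L1_cindic_itv b (ltW a0).
  rewrite -(Cintegral_cindic _ aD) (_ : Cintegral _ _ = 0) ?normc0//.
  under eq_Cintegral do rewrite L0inf_valB mulrBl.
  rewrite CintegralB; [|exact: measurable_itv|exact: cintegrable_mul_L1..].
  by rewrite !Cintegral_cindic// fg// subrr.
have := ae_le_normw (f - g).
apply: (@filterS _ _ (ae_filter_ringOfSetsType mu)) => x /[swap] x0 /(_ x0) fgx.
apply/eqP; rewrite -subr_eq0; apply/eqP/eq0_normc/le_anti; rewrite normc_ge0 andbT.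
by rewrite (le_trans fgx)// mulr_le0_ge0 ?weight_ge0.
Qed.

End uniqueness.

(** * The dual of L^1(w) *)

Lemma cmeasurable_funB (R : realType) (D : set R) (f g : R -> R[i]) : measurable D ->
  cmeasurable_fun D f -> cmeasurable_fun D g ->
  cmeasurable_fun D (fun x => f x - g x).
Proof.
move=> mD mf mg; rewrite (_ : (fun _ => _) = (fun x => f x + (-1) * g x)).
  by apply: cmeasurable_funD => //; apply: cmeasurable_funM => //; exact: cmeasurable_cst.
by apply/funext => x; rewrite mulN1r.
Qed.

Section L1_functionals.
Context {R : realType} (w : weight R).
Local Notation mu := (@lebesgue_measure R).
Local Notation DD := (`[0%R, +oo[%classic : set R).
Implicit Types (phi psi : R -> R[i]).

(** Dominated convergence in L^1(w): by the triangle inequality the weighted difference is at most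
    [2 * v]. *)
Lemma normL1_dct (phi_ : nat -> R -> R[i]) phi (v : R -> R) :
  (forall n, cmeasurable_fun DD (phi_ n)) -> cmeasurable_fun DD phi ->
  mu.-integrable DD (EFin \o v) ->
  (forall n x, 0 <= x -> w x * normc (phi_ n x) <= v x) ->
  (forall x, 0 <= x -> w x * normc (phi x) <= v x) ->
  (forall x, 0 <= x -> normc (phi_ n x - phi x) @[n --> \oo] --> 0) ->
  normL1 w (fun x => phi_ n x - phi x) @[n --> \oo] --> 0.
Proof.
move=> mphi_ mphi vI phi_v phiv phi_phi.
have mD : measurable DD by exact: measurable_itv.
have mn n : measurable_fun DD (EFin \o (fun x => w x * normc (phi_ n x - phi x))).
  apply/measurable_EFinP; apply: measurable_funM; first exact: measurable_weight.
  have mB : cmeasurable_fun DD (fun x => phi_ n x - phi x).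
    exact: cmeasurable_funB.
  exact: measurable_normc mB.
have [] := @dominated_convergence _ _ _ mu DD mD
  (fun n => EFin \o (fun x => w x * normc (phi_ n x - phi x))) (cst 0%E)
  (EFin \o (fun x => 2 * v x)).
- exact: mn.
- exact: measurable_cst.
- apply: aeW => x; rewrite /= in_itv/= andbT => x0.
  apply/cvg_EFin; first by apply: nearW.
  rewrite /= -[X in _ --> X](mulr0 (w x)); apply: cvgMr.
  exact: phi_phi.
- exact: integrable_EFinZ.
- apply: aeW => x n; rewrite /= in_itv/= andbT => x0; rewrite lee_fin ger0_norm; last first.
    by rewrite mulr_ge0 ?weight_ge0 ?normc_ge0.
  rewrite (le_trans (ler_wpM2l (weight_ge0 w x0) (le_normcD _ _)))//.
  by rewrite mulrDr normcN mulr_natl mulr2n lerD ?phi_v ?phiv.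
move=> _ _ /=; rewrite integral0 => /fine_cvgP[_]; exact.
Qed.

Definition expd : R -> R := exponential_pdf 1.

Lemma expd_ge0 x : 0 <= expd x.
Proof. exact: exponential_pdf_ge0. Qed.

Lemma expd_gt0 x : 0 <= x -> 0 < expd x.
Proof. by move=> x0; rewrite /expd exponential_pdfE// mul1r expR_gt0. Qed.

Lemma expd_integrable (D : set R) : measurable D -> mu.-integrable D (EFin \o expd).
Proof.
move=> mD; have := @integrable_exponential_pdf R 1 ltr01.
by move=> h; apply: integrableS h.
Qed.

(** Strictly positive on the half-line, with [w * expw] integrable: an indicator multiplied by it
    lies in L^1(w) for every measurable set, even one of infinite length. *)
Definition expw (x : R) : R := expd x / w x.

Lemma weight_expw x : 0 <= x -> w x * expw x = expd x.
Proof. by move=> x0; rewrite /expw mulrC divfK// gt_eqF// weight_gt0. Qed.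

Lemma expw_gt0 x : 0 <= x -> 0 < expw x.
Proof. by move=> x0; rewrite divr_gt0 ?expd_gt0 ?weight_gt0. Qed.

Lemma measurable_expw : measurable_fun DD expw.
Proof.
apply: measurable_funM.
  by apply: measurable_funTS; exact: measurable_exponential_pdf.
(* As [w] is positive, its inverse is exp(- ln w), a composite of measurable functions. *)
apply: (eq_measurable_fun (fun x => expR (- ln (w x)))).
  move=> x; rewrite inE/= in_itv/= andbT => x0.
  by rewrite expRN lnK// posrE weight_gt0.
apply: measurableT_comp; first exact: measurable_expR.
apply: measurableT_comp => //; apply: measurableT_comp; first exact: measurable_ln.
exact: measurable_weight.
Qed.

Definition expw_indic (E : set R) (x : R) : R[i] := (expw x)%:C%C * cindic E x.

Lemma cmeasurable_expw_indic E : measurable E -> cmeasurable_fun DD (expw_indic E).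
Proof.
move=> mE; apply: cmeasurable_funM => //; last exact: cmeasurable_cindic.
by apply: cmeasurable_real; exact: measurable_expw.
Qed.

Lemma normc_expw_indic E x : 0 <= x ->
  w x * normc (expw_indic E x) = (expd \_ E) x.
Proof.
move=> x0; rewrite /expw_indic normcM normc_real ger0_norm ?ltW ?expw_gt0//.
rewrite mulrA weight_expw// cindicE patchE; case: ifP => _.
  by rewrite normc1 mulr1.
by rewrite normc0 mulr0.
Qed.

Lemma expw_indic_le E x : 0 <= x -> w x * normc (expw_indic E x) <= expd x.
Proof.
by move=> x0; rewrite normc_expw_indic// patchE; case: ifP => // _; exact: expd_ge0.
Qed.

Lemma L1_expw_indic E : measurable E -> L1 w (expw_indic E).
Proof.
move=> mE; apply: (L1I (cmeasurable_expw_indic mE) _ (expw_indic_le E)).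
by apply: expd_integrable; exact: measurable_itv.
Qed.

Lemma normL1_expw_indic E : measurable E -> E `<=` DD ->
  normL1 w (expw_indic E) = \int[mu]_(x in E) expd x.
Proof.
move=> mE ED; rewrite /normL1.
rewrite (@eq_Rintegral _ _ _ mu DD (expd \_ E)); last first.
  by move=> x /set_mem; rewrite /= in_itv/= andbT => x0; rewrite normc_expw_indic.
by rewrite -Rintegral_mkcondr setIidr.
Qed.

Section real_density.
Context (G : (R -> R[i]) -> R) (c : R).
Hypothesis GD : forall phi psi, L1 w phi -> L1 w psi ->
  G (fun x => phi x + psi x) = G phi + G psi.
Hypothesis Gc : forall phi, L1 w phi -> `|G phi| <= c * normL1 w phi.

Let GB phi psi : L1 w phi -> L1 w psi ->
  `|G phi - G psi| <= c * normL1 w (fun x => phi x - psi x).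
Proof.
move=> phi1 psi1; have B1 := L1B phi1 psi1.
apply: le_trans (Gc B1); rewrite le_eqVlt; apply/orP; left; apply/eqP; congr `|_|.
have := GD B1 psi1; rewrite (_ : (fun x => _) = phi).
  by move=> ->; rewrite addrK.
by apply/funext => x; rewrite subrK.
Qed.

(** Absolute continuity: [expw_indic E] has norm zero in L^1(w) when [E] is negligible. *)
Let G_null E : measurable E -> mu E = 0 -> G (expw_indic E) = 0.
Proof.
move=> mE E0; apply/eqP; rewrite -normr_le0.
apply: le_trans (Gc (L1_expw_indic mE)) _.
suff -> : normL1 w (expw_indic E) = 0 by rewrite mulr0.
rewrite /normL1 (@eq_Rintegral _ _ _ mu DD (expd \_ E)); last first.
  by move=> x /set_mem; rewrite /= in_itv/= andbT => x0; rewrite normc_expw_indic.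
rewrite -Rintegral_mkcondr /Rintegral null_set_integral//.
- by apply: measurableI => //; exact: measurable_itv.
- apply: measurable_int; apply: expd_integrable.
  by apply: measurableI => //; exact: measurable_itv.
- by apply/eqP; rewrite eq_le measure_ge0 andbT -E0 le_measure ?inE//;
    apply: measurableI => //; exact: measurable_itv.
Qed.

Let nu (E : set (measurableTypeR R)) : \bar R := (G (expw_indic E))%:E.

Let nu0 : nu set0 = 0%E.
Proof. by rewrite /nu G_null. Qed.

Let nufin E : measurable E -> nu E \is a fin_num.
Proof. by []. Qed.

(** Finite additivity is [GD] on disjoint indicators. For the infinite union, the indicators of the
    partial unions are eventually constant at each point and, once weighted, dominated by the
    exponential density, so they converge in L^1(w), on which [G] is bounded. *)
Let nusigma : semi_sigma_additive nu.
Proof.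
move=> F mF tF mUF.
have mUn n : measurable (\big[setU/set0]_(i < n) F i) by exact: bigsetU_measurable.
have sumE n : (\sum_(0 <= i < n) nu (F i))%E = nu (\big[setU/set0]_(i < n) F i).
  elim: n => [|n IH]; first by rewrite big_geq// big_ord0 nu0.
  rewrite big_nat_recr//= IH big_ord_recr/= /nu -EFinD.
  rewrite -(GD (L1_expw_indic (mUn n)) (L1_expw_indic (mF n))).
  congr ((G _)%:E); apply/funext => x; rewrite /expw_indic -mulrDr; congr (_ * _).
  rewrite !cindicE in_setU.
  have [xn|xn] := boolP (x \in \big[setU/set0]_(i < n) F i).
    rewrite memNset ?addr0// => Fnx.
    move: xn; rewrite inE -bigcup_mkord => -[i /= ni Fix].
    have := tF n i Logic.I Logic.I (ex_intro _ x (conj Fnx Fix)).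
    by move=> ni'; move: ni; rewrite -ni' ltnn.
  by rewrite /= add0r.
under eq_fun do rewrite sumE.
apply/fine_cvgP; split; first exact: nearW.
apply/cvgrPdist_le => e e0.
pose phi_ n := expw_indic (\big[setU/set0]_(i < n) F i).
pose phi := expw_indic (\bigcup_n F n).
have phi_cvg : c * normL1 w (fun x => phi_ n x - phi x) @[n --> \oo] --> 0.
  rewrite -[X in _ --> X](mulr0 c); apply: cvgMr.
  apply: (@normL1_dct _ _ expd) => //.
  - by move=> n; exact: cmeasurable_expw_indic (mUn n).
  - exact: cmeasurable_expw_indic mUF.
  - by apply: expd_integrable; exact: measurable_itv.
  - by move=> n x; exact: expw_indic_le.
  - by move=> x; exact: expw_indic_le.
  - move=> x x0; apply: cvg_near_cst.
    have [[k _ Fkx]|nFx] := pselect ((\bigcup_n F n) x).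
      near=> n; rewrite /phi_ /phi /expw_indic !cindicE !mem_set ?subrr ?normc0//.
        by exists k.
      rewrite -bigcup_mkord; exists k => //=; near: n; exact: nbhs_infty_gt.
    apply: nearW => n; rewrite /phi_ /phi /expw_indic !cindicE !memNset ?subrr ?normc0//.
    by rewrite -bigcup_mkord => -[k _ Fkx]; apply: nFx; exists k.
move/cvgrPdist_le : phi_cvg => /(_ _ e0); apply: filterS => n.
rewrite sub0r normrN => /(le_trans (ler_norm _)); apply: le_trans.
by rewrite distrC; exact: GB (L1_expw_indic (mUn n)) (L1_expw_indic mUF).
Unshelve. all: by end_near. Qed.

Lemma real_density : exists2 h : R -> R, mu.-integrable setT (EFin \o h) &
  forall E, measurable E -> G (expw_indic E) = \int[mu]_(x in E) h x.
Proof.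
pose nuC : {charge set (measurableTypeR R) -> \bar R} :=
  HB.pack nu (isCharge.Build _ _ _ nu nu0 nufin nusigma).
have nuac : nuC `<< mu.
  by apply/null_content_dominatesP => E mE E0; rewrite /= /nu G_null.
have RNI := Radon_Nikodym_integrable nuac.
have RNfin x := Radon_Nikodym_fin_num x nuac.
exists (fun x => fine (Radon_Nikodym nuC mu x)).
  apply: eq_integrable RNI => // x _; rewrite /= fineK//.
move=> E mE; have := Radon_Nikodym_integral nuac mE.
rewrite /= {1}/nu /Rintegral => EE; apply: EFin_inj; rewrite EE.
under [in RHS]eq_integral do rewrite fineK//.
rewrite fineK//; apply: integrable_fin_num => //.
by apply: integrableS RNI.
Qed.

End real_density.

End L1_functionals.

(** * Bounded functionals on L^1(w) are integrals against a function bounded by a multiple of w *)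

Section L1_representation.
Context {R : realType} (w : weight R).
Local Notation mu := (@lebesgue_measure R).
Local Notation DD := (`[0%R, +oo[%classic : set R).
Implicit Types (phi psi : R -> R[i]).

Definition L1_bounded_linear (c : R) (F : (R -> R[i]) -> R[i]) :=
  (forall a phi psi, L1 w phi -> L1 w psi ->
    F (fun x => a * phi x + psi x) = a * F phi + F psi) /\
  (forall phi, L1 w phi -> normc (F phi) <= c * normL1 w phi).

Lemma L1_bounded_linearD c F phi psi : L1_bounded_linear c F -> L1 w phi -> L1 w psi ->
  F (fun x => phi x + psi x) = F phi + F psi.
Proof.
move=> [Fl _] phi1 psi1; have := Fl 1 _ _ phi1 psi1; rewrite mul1r => <-.
by congr F; apply/funext => x; rewrite mul1r.
Qed.

Lemma L1_bounded_linearB c F phi psi : L1_bounded_linear c F -> L1 w phi -> L1 w psi ->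
  F (fun x => phi x - psi x) = F phi - F psi.
Proof.
move=> [Fl _] phi1 psi1; have := Fl (-1) _ _ psi1 phi1; rewrite mulN1r addrC => <-.
by congr F; apply/funext => x; rewrite mulN1r addrC.
Qed.

Lemma L1_0 : L1 w (fun=> 0).
Proof.
have := L1_expw_indic w measurable0; rewrite (_ : expw_indic w set0 = fun=> 0)//.
by apply/funext => x; rewrite /expw_indic cindicE in_set0 mulr0.
Qed.

Lemma L1_bounded_linear0 c F : L1_bounded_linear c F -> F (fun=> 0) = 0.
Proof.
move=> Fcl; rewrite -[RHS](subrr (F (fun=> 0))) -(L1_bounded_linearB Fcl L1_0 L1_0).
by congr F; apply/funext => x; rewrite subrr.
Qed.

Lemma L1_sum (I : Type) (r : seq I) (phi_ : I -> R -> R[i]) :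
  (forall i, L1 w (phi_ i)) -> L1 w (fun x => \sum_(i <- r) phi_ i x).
Proof.
move=> phi1; elim: r => [|i r IH].
  by under eq_fun do rewrite big_nil; exact: L1_0.
by under eq_fun do rewrite big_cons; exact: L1D.
Qed.

Lemma L1_bounded_linear_sum c F (I : Type) (r : seq I) (phi_ : I -> R -> R[i]) :
  L1_bounded_linear c F -> (forall i, L1 w (phi_ i)) ->
  F (fun x => \sum_(i <- r) phi_ i x) = \sum_(i <- r) F (phi_ i).
Proof.
move=> Fcl phi1; elim: r => [|i r IH].
  rewrite big_nil -[RHS](L1_bounded_linear0 Fcl); congr F.
  by apply/funext => x; rewrite big_nil.
rewrite big_cons -IH -(L1_bounded_linearD Fcl (phi1 i) (L1_sum r phi1)).
by congr F; apply/funext => x; rewrite big_cons.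
Qed.

Lemma expwK x : 0 <= x -> expw w x * (w x * expR x) = 1.
Proof.
move=> x0; rewrite mulrA [expw w x * _]mulrC weight_expw// /expd exponential_pdfE//.
by rewrite mul1r mulN1r -expRD addNr expR0.
Qed.

(** Density argument: on the half-line [p] is [expw] times p w e^x, and the second factor is a limit
    from below of nonnegative simple functions [s n]. Then [expw] times [s n] is a combination of
    functions [expw_indic E], lies below [p], and tends to [p] in L^1(w) by dominated
    convergence. *)
Lemma L1_bounded_linear_eq0_real c F (p : R -> R) : L1_bounded_linear c F ->
  (forall E, measurable E -> F (expw_indic w E) = 0) ->
  measurable_fun DD p -> (forall x, 0 <= p x) -> L1 w (fun x => (p x)%:C%C) ->
  F (fun x => (p x)%:C%C) = 0.
Proof.
move=> Fcl F0 mp p0 pL.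
have mD : measurable DD by exact: measurable_itv.
pose psi x : \bar R := (p x * (w x * expR x))%:E.
have mpsi : measurable_fun DD psi.
  apply/measurable_EFinP; apply: measurable_funM => //; apply: measurable_funM.
    exact: measurable_weight.
  by apply: measurable_funTS; exact: measurable_expR.
have psi0 x : DD x -> (0 <= psi x)%E.
  rewrite /= in_itv/= andbT => x0.
  by rewrite lee_fin !mulr_ge0 ?weight_ge0 ?expR_ge0.
pose s := nnsfun_approx mD mpsi.
pose phi_ n x := (expw w x)%:C%C * (s n x)%:C%C.
have s_le n x : 0 <= x -> expw w x * s n x <= p x.
  move=> x0; have := le_approx n psi0; rewrite -nnsfun_approxE -/s => /(_ x).
  rewrite /= in_itv/= andbT => /(_ x0); rewrite lee_fin => sp.
  rewrite (le_trans (ler_wpM2l (ltW (expw_gt0 w x0)) sp))//.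
  by rewrite mulrCA expwK// mulr1.
have mphi n : cmeasurable_fun DD (phi_ n).
  apply: cmeasurable_funM => //; apply: cmeasurable_real.
    exact: measurable_expw.
  by apply: measurable_funTS; exact: measurable_funP.
have phi_le n x : 0 <= x -> w x * normc (phi_ n x) <= w x * p x.
  move=> x0; rewrite ler_wpM2l ?weight_ge0// normcM !normc_real.
  rewrite ger0_norm ?(ltW (expw_gt0 w x0))// ger0_norm ?s_le//.
have vI : mu.-integrable DD (EFin \o (fun x => w x * p x)).
  have /L1P[_] := pL; apply: eq_integrable => // x _.
  by rewrite /= expr0n/= addr0 sqrtr_sqr ger0_norm.
have phi1 n : L1 w (phi_ n) by exact: L1I (mphi n) vI (phi_le n).
have Fphi n : F (phi_ n) = 0.
  pose r := finmap.enum_fset (fset_set (range (s n))).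
  have -> : phi_ n = fun x => \sum_(y <- r) y%:C%C * expw_indic w (s n @^-1` [set y]) x.
    apply/funext => x; rewrite /phi_ fimfunE fsbig_finite//=.
    rewrite (raddf_sum (real_complex R)) mulr_sumr; apply: eq_bigr => y _.
    by rewrite /expw_indic /cindic -!rmorphM; congr (_%:C%C); rewrite mulrCA.
  have L1y y : L1 w (fun x => y%:C%C * expw_indic w (s n @^-1` [set y]) x).
    by apply: L1Z; apply: L1_expw_indic; exact: measurable_sfunP.
  rewrite (L1_bounded_linear_sum r Fcl L1y) big1// => y _.
  have ymE := measurable_sfunP (s n) (measurable_set1 y).
  have [Fl _] := Fcl; have := Fl y%:C%C _ _ (L1_expw_indic w ymE) L1_0.
  rewrite (L1_bounded_linear0 Fcl) F0; last exact: measurable_sfunP.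
  by rewrite mulr0 addr0 => <-; congr F; apply/funext => x; rewrite addr0.
apply/eq0_normc/le_anti; rewrite normc_ge0 andbT.
have cvg0 : c * normL1 w (fun x => phi_ n x - (p x)%:C%C) @[n --> \oo] --> 0.
  rewrite -[X in _ --> X](mulr0 c); apply: cvgMr.
  apply: (@normL1_dct _ _ _ _ (fun x => w x * p x)) => //.
  - by move=> x x0; rewrite normc_real ger0_norm.
  - move=> x x0.
    have sx : s n x @[n --> \oo] --> p x * (w x * expR x).
      have := @cvg_nnsfun_approx _ _ _ _ mD _ mpsi psi0 x.
      by rewrite /= in_itv/= andbT => /(_ x0) /fine_cvgP[_].
    rewrite (_ : (fun n => _) = (fun n => `|expw w x * s n x - p x|)); last first.
      by apply/funext => n; rewrite /phi_ -rmorphM -rmorphB normc_real.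
    rewrite -[X in _ --> X](normr0 R) -(subrr (p x)); apply: cvg_norm.
    apply: cvgB; last exact: cvg_cst.
    rewrite -[X in _ --> X]mulr1 -(expwK x0) mulrCA; apply: cvgMr; exact: sx.
rewrite -(cvg_lim _ cvg0)//; apply: limr_ge; first by apply/cvg_ex; exists 0.
near=> n.
have [_ Fb] := Fcl; apply: le_trans (Fb _ (L1B (phi1 n) pL)).
by rewrite (L1_bounded_linearB Fcl (phi1 n) pL) Fphi sub0r normcN.
Unshelve. all: by end_near. Qed.

(** Real and imaginary parts are split into positive and negative parts, each dominated by the
    modulus of [phi] and hence in L^1(w). *)
Lemma L1_bounded_linear_eq0 c F phi : L1_bounded_linear c F ->
  (forall E, measurable E -> F (expw_indic w E) = 0) -> L1 w phi -> F phi = 0.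
Proof.
move=> Fcl F0 phi1; have [[mr mi] phiI] := (L1P w phi).1 phi1.
have part (h : R -> R) : measurable_fun DD h -> (forall x, 0 <= h x <= normc (phi x)) ->
    L1 w (fun x => (h x)%:C%C) /\ F (fun x => (h x)%:C%C) = 0.
  move=> mh hphi.
  have hL : L1 w (fun x => (h x)%:C%C).
    apply: (L1I (cmeasurable_real mh) phiI) => x x0.
    have /andP[h0 hx] := hphi x.
    by rewrite normc_real ger0_norm// ler_wpM2l ?weight_ge0.
  split=> //; apply: L1_bounded_linear_eq0_real Fcl F0 mh _ hL.
  by move=> x; have /andP[] := hphi x.
have abs_part (h : R -> R) : measurable_fun DD h -> (forall x, `|h x| <= normc (phi x)) ->
    L1 w (fun x => (h x)%:C%C) /\ F (fun x => (h x)%:C%C) = 0.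
  move=> mh hphi.
  have [pL F_p] : L1 w (fun x => (Num.max (h x) 0)%:C%C) /\
      F (fun x => (Num.max (h x) 0)%:C%C) = 0.
    apply: part; first by apply: measurable_maxr => //; exact: measurable_cst.
    by move=> x; rewrite le_max lexx orbT/= (le_trans _ (hphi x))// ge_max ler_norm/=.
  have [nL F_n] : L1 w (fun x => (Num.max (- h x) 0)%:C%C) /\
      F (fun x => (Num.max (- h x) 0)%:C%C) = 0.
    apply: part; first by apply: measurable_maxr; [exact: measurableT_comp|exact: measurable_cst].
    move=> x; rewrite le_max lexx orbT/= (le_trans _ (hphi x))//.
    by rewrite ge_max normr_ge0 andbT -normrN ler_norm.
  have E : (fun x => (h x)%:C%C) =
      (fun x => (Num.max (h x) 0)%:C%C - (Num.max (- h x) 0)%:C%C).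
    apply/funext => x; rewrite -rmorphB; congr (_%:C%C).
    have [h0|h0] := leP 0 (h x).
      by rewrite max_r ?subr0// oppr_le0.
    by rewrite max_l ?sub0r ?opprK// oppr_ge0 ltW.
  rewrite E; split; first exact: L1B.
  by rewrite (L1_bounded_linearB Fcl pL nL) F_p F_n subrr.
have [rL F_r] := abs_part _ mr (fun x => Re_le_normc (phi x)).
have [iL F_i] := abs_part _ mi (fun x => Im_le_normc (phi x)).
have [Fl _] := Fcl; have := Fl 'i%C _ _ iL rL; rewrite F_r F_i mulr0 addr0 => <-.
by congr F; apply/funext => x; rewrite [LHS]complexE addrC.
Qed.

(** With [h] the density of E |-> F(expw 1_E), the function sought is [h] divided by [expw].
    Agreement on the functions [expw_indic E] extends to L^1(w) by [L1_bounded_linear_eq0]. *)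
Lemma L1_representation c F : 0 <= c -> L1_bounded_linear c F ->
  exists g : R -> R[i], [/\ cmeasurable_fun DD g,
    {ae mu, forall x, 0 <= x -> normc (g x) <= c * w x} &
    forall phi, L1 w phi -> F phi = Cintegral DD (fun x => g x * phi x)].
Proof.
move=> c0 Fcl; have [Fl Fb] := Fcl.
have mD : measurable DD by exact: measurable_itv.
have [h1 h1I h1E] : exists2 h : R -> R, mu.-integrable setT (EFin \o h) &
    forall E, measurable E -> complex.Re (F (expw_indic w E)) = \int[mu]_(x in E) h x.
  apply: (@real_density _ w (fun phi => complex.Re (F phi)) c).
    by move=> phi psi phi1 psi1; rewrite (L1_bounded_linearD Fcl)// raddfD.
  by move=> phi phi1; apply: le_trans (Re_le_normc _) (Fb _ phi1).
have [h2 h2I h2E] : exists2 h : R -> R, mu.-integrable setT (EFin \o h) &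
    forall E, measurable E -> complex.Im (F (expw_indic w E)) = \int[mu]_(x in E) h x.
  apply: (@real_density _ w (fun phi => complex.Im (F phi)) c).
    by move=> phi psi phi1 psi1; rewrite (L1_bounded_linearD Fcl)// raddfD.
  by move=> phi phi1; apply: le_trans (Im_le_normc _) (Fb _ phi1).
pose h x := (h1 x +i* h2 x)%C.
have hI E : measurable E -> cintegrable E h.
  by move=> mE; split; [apply: integrableS h1I|apply: integrableS h2I].
have Fh E : measurable E -> F (expw_indic w E) = Cintegral E h.
  move=> mE; rewrite /Cintegral -h1E// -h2E//.
  by case: (F _).
(* The norm of [expw_indic] of an interval is the integral of [expd], so the bound on [F] is an
   interval inequality for [h]. *)
have h_le : {ae mu, forall x, 0 <= x -> normc (h x) <= c * expd x}.
  apply: ae_ge0_gt0; apply: ae_normc_le_itv.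
  - by apply: open_integrable_locally => //; exact: openT.
  - by apply: open_integrable_locally => //; exact: openT.
  - apply: open_integrable_locally; first exact: openT.
    by apply: integrable_EFinZ => //; exact: expd_integrable.
  - move=> a b a0 ab; have mab : measurable `]a, b]%classic by exact: measurable_itv.
    rewrite RintegralZl//; last exact: expd_integrable.
    rewrite -(normL1_expw_indic w mab (sub_itv_DD (ltW a0))).
    by have := Fb _ (L1_expw_indic w mab); rewrite Fh.
(* On the half-line [w x * expR x] is the inverse of [expw x]. *)
pose g x := h x * (w x * expR x)%:C%C.
have mg : cmeasurable_fun DD g.
  apply: cmeasurable_funM => //; first exact: cintegrable_measurable (hI _ mD).
  apply: cmeasurable_real; apply: measurable_funM; first exact: measurable_weight.
  by apply: measurable_funTS; exact: measurable_expR.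
have g_le : {ae mu, forall x, 0 <= x -> normc (g x) <= c * w x}.
  apply: (@filterS _ _ (ae_filter_ringOfSetsType mu) _ _ _ h_le) => x hx x0.
  rewrite /g normcM normc_real ger0_norm ?mulr_ge0 ?weight_ge0 ?expR_ge0//.
  rewrite (le_trans (ler_wpM2r _ (hx x0))) ?mulr_ge0 ?weight_ge0 ?expR_ge0//.
  have E : expd x * (w x * expR x) = w x.
    by rewrite -(weight_expw w x0) -mulrA expwK ?mulr1.
  by rewrite -mulrA E.
have gI phi : L1 w phi -> cintegrable DD (fun x => g x * phi x) /\
    normc (Cintegral DD (fun x => g x * phi x)) <= c * normL1 w phi.
  move=> phi1; have /L1P[mphi phiI] := phi1.
  have mgp : cmeasurable_fun DD (fun x => g x * phi x) by exact: cmeasurable_funM.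
  have c'I : mu.-integrable DD (EFin \o (fun x => c * (w x * normc (phi x)))).
    exact: integrable_EFinZ.
  have gv : {ae mu, forall x, DD x -> normc (g x * phi x) <= c * (w x * normc (phi x))}.
    apply: (@filterS _ _ (ae_filter_ringOfSetsType mu) _ _ _ g_le) => x gx.
    rewrite /= in_itv/= andbT => x0.
    by rewrite normcM mulrA ler_wpM2r ?normc_ge0// gx.
  split; first exact: le_cintegrable c'I gv.
  rewrite -RintegralZl//; apply: le_normc_Cintegral => //.
  by move=> x; rewrite /= in_itv/= andbT => x0; rewrite !mulr_ge0 ?weight_ge0 ?normc_ge0.
exists g; split => // phi phi1.
pose F' phi := F phi - Cintegral DD (fun x => g x * phi x).
suff : F' phi = 0 by move/eqP; rewrite subr_eq0 => /eqP.
have F'cl : L1_bounded_linear (c + c) F'.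
  split.
    move=> a phi' psi phi'1 psi1; rewrite /F' Fl// mulrBr.
    have -> : Cintegral DD (fun x => g x * (a * phi' x + psi x)) =
        a * Cintegral DD (fun x => g x * phi' x) + Cintegral DD (fun x => g x * psi x).
      rewrite -CintegralZ//; last exact: (gI _ phi'1).1.
      rewrite -CintegralD//; last exact: (gI _ psi1).1.
        by apply: eq_Cintegral => x _; rewrite mulrDr mulrCA.
      by apply: cintegrableZ => //; exact: (gI _ phi'1).1.
    by rewrite opprD addrACA.
  move=> phi' phi'1; rewrite mulrDl (le_trans (le_normcD _ _))// normcN.
  by rewrite lerD ?Fb//; exact: (gI _ phi'1).2.
apply: L1_bounded_linear_eq0 F'cl _ phi1 => E mE; apply/eqP; rewrite subr_eq0; apply/eqP.
(* [E] may contain negative reals, but the exponential density vanishes there. *)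
have -> : expw_indic w E = expw_indic w (E `&` DD).
  apply/funext => x; rewrite /expw_indic !cindicE in_setI.
  have [//|xD] := boolP (x \in DD); first by rewrite andbT.
  rewrite /expw /expd lt0_exponential_pdf ?mul0r//.
  by move: xD; rewrite notin_setE /= in_itv/= andbT => /negP; rewrite -ltNge.
have mED : measurable (E `&` DD) by exact: measurableI.
rewrite Fh// -(@Cintegral_cindic _ DD (E `&` DD) h); last exact: subIsetr.
apply: eq_Cintegral => x; rewrite /= in_itv/= andbT => x0.
rewrite /g /expw_indic mulrA -[h x * _ * _]mulrA -rmorphM [_ * expw w x]mulrC.
by rewrite expwK// mulr1.
Qed.

End L1_representation.

(** * The Arens product *)

Section action.
Context {R : realType} (w : weight R).
Local Notation mu := (@lebesgue_measure R).
Local Notation DD := (`[0%R, +oo[%classic : set R).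
Implicit Types (f g : L0inf w) (m n : dual w) (phi psi : R -> R[i]).

(** The representation theorem is applied to phi |-> n(f phi). For the decay at infinity: when phi
    lives on []a, b]] beyond [X], f phi only involves values of [f] beyond [X] and is therefore
    small. *)
Lemma act_exists n f : exists g : L0inf w, forall phi, L1 w phi ->
  Cintegral DD (fun x => g x * phi x) = n (L0inf_conv f phi).
Proof.
have [M M0 nM] := dual_bounded n.
have Fcl : L1_bounded_linear w (M * normw w f) (fun phi => n (L0inf_conv f phi)).
  split; first by move=> a phi psi phi1 psi1; exact: dual_conv_linearr.
  move=> phi phi1; apply: le_trans (nM _) _; rewrite -mulrA ler_wpM2l ?(ltW M0)//.
  exact: normw_conv.
have c0 : 0 <= M * normw w f by rewrite mulr_ge0 ?normw_ge0// ltW.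
have [g [mg g_le gE]] := L1_representation c0 Fcl.
have gL : isL0inf w g.
  apply: (isL0infI mg g_le) => e e0.
  (* The tail of [f] is taken below [e / M] to absorb the bound [M] of [n]. *)
  have eM0 : 0 < e / M by rewrite divr_gt0.
  have [X X0 fX] := ae_le_tail f eM0; exists X.
  suff : {ae mu, forall x, X < x -> normc (g x) <= e * w x}.
    by apply: (@filterS _ _ (ae_filter_ringOfSetsType mu)) => x gx _; exact: gx.
  apply: (ae_normc_le_weight mg g_le X0) => a b Xa ab.
  have a0 : 0 <= a by rewrite (le_trans X0)// ltW.
  have [phi1 phiE] := L1_cindic_itv w b a0.
  rewrite -(Cintegral_cindic g (@sub_itv_DD _ a b a0)) -gE//.
  apply: le_trans (nM _) _; rewrite -ler_pdivlMl// mulrA [M^-1 * e]mulrC -phiE.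
  apply: normw_le; apply: aeW => x x0.
  rewrite (L0inf_convE phi1) mulrAC.
  apply: (@conv_bound _ _ _ _ (fun z => X < z) _ _ (L0inf_cmeasurable f) phi1 x0 (ltW eM0) _ _).2.
    by apply: (@filterS _ _ (ae_filter_ringOfSetsType mu) _ _ _ fX) => z + _; exact.
  move=> y y0; rewrite cindicE; case: ifPn => [|_]; last by rewrite eqxx.
  rewrite inE/= in_itv/= => /andP[ay _] _.
  by rewrite (lt_le_trans Xa)// (le_trans (ltW ay))// lerDr.
exists (mkL0inf (mem_set gL : g \in L0inf_pred w)) => phi phi1.
by rewrite gE.
Qed.

Lemma actP n f phi : L1 w phi ->
  Cintegral DD (fun x => act n f x * phi x) = n (L0inf_conv f phi).
Proof.
move=> phi1; rewrite /act.
by have := xgetPex 0 (act_exists n f); exact.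
Qed.

Opaque act.

Lemma normw_act n : exists2 M, 0 < M & forall f, normw w (act n f) <= M * normw w f.
Proof.
have [M M0 nM] := dual_conv_normw n; exists M => // f.
by apply: normw_le_L1 => phi phi1; rewrite actP//; exact: nM.
Qed.

Lemma Cintegral_act n f a b : 0 < a ->
  Cintegral `]a, b] (act n f) = n (L0inf_conv f (cindic `]a, b])).
Proof.
move=> a0; have [phi1 _] := L1_cindic_itv w b (ltW a0).
apply: etrans (actP n f phi1); apply: esym.
exact: Cintegral_cindic (@sub_itv_DD _ a b (ltW a0)).
Qed.

(** [act] chooses a representative for each argument separately, so linearity is only obtained
    almost everywhere. *)
Lemma act_linear n a f g :
  {ae mu, forall x, 0 <= x -> act n (a *: f + g) x = (a *: act n f + act n g) x}.
Proof.
apply: L0inf_ae_eq_itv => s t s0 st.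
have [phi1 _] := L1_cindic_itv w t (ltW s0).
rewrite -!(Cintegral_cindic _ (@sub_itv_DD _ s t (ltW s0))).
apply: (etrans (actP n (a *: f + g) phi1)).
apply: (etrans (dual_conv_linearl n a f g phi1)).
have -> : Cintegral DD (fun x => (a *: act n f + act n g) x * cindic `]s, t] x) =
    a * Cintegral DD (fun x => act n f x * cindic `]s, t] x) +
    Cintegral DD (fun x => act n g x * cindic `]s, t] x).
  rewrite -CintegralZ; [|exact: measurable_itv|exact: cintegrable_mul_L1].
  rewrite -CintegralD; [|exact: measurable_itv| |exact: cintegrable_mul_L1].
    by apply: eq_Cintegral => x _; rewrite L0inf_valD L0inf_valZ mulrDl mulrA.
  by apply: cintegrableZ; [exact: measurable_itv|exact: cintegrable_mul_L1].
by congr (_ * _ + _); apply: esym; exact: actP.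
Qed.

(** f |-> m(n f) is linear although [act n] is so only almost everywhere, because [m] ignores null
    sets; hence it belongs to the dual. *)
Lemma arensE m n f : arens m n f = m (act n f).
Proof.
suff mn : isdual (fun f => m (act n f)).
  rewrite /arens -[dual_val _]/(val _) val_insubd.
  by rewrite (_ : (fun f => m (act n f)) \in _)// inE.
split.
  by move=> a g h; apply: (etrans (dual_ae_eq m (act_linear n a g h))); exact: dual_linear.
have [M M0 mM] := dual_bounded m; have [N N0 nN] := normw_act n.
exists (M * N) => g; rewrite (le_trans (mM _))// -mulrA ler_wpM2l ?(ltW M0)//.
Qed.

Opaque arens.

Lemma dual_valD m n f : (m + n) f = m f + n f.
Proof. by []. Qed.

Lemma dual_valB m n f : (m - n) f = m f - n f.
Proof. by []. Qed.

Lemma arens0l n : arens 0 n = 0.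
Proof. by apply: dual_ext => f; rewrite arensE. Qed.

Lemma arensDr m n n' : arens m (n + n') = arens m n + arens m n'.
Proof.
apply: dual_ext => f; rewrite dual_valD !arensE -dualD; apply: dual_ae_eq.
apply: L0inf_ae_eq_itv => a b a0 ab.
have [phi1 _] := L1_cindic_itv w b (ltW a0).
rewrite -!(Cintegral_cindic _ (@sub_itv_DD _ a b (ltW a0))) actP//.
rewrite dual_valD -!actP// -CintegralD ?measurable_itv//; try exact: cintegrable_mul_L1.
by apply: eq_Cintegral => x _; rewrite L0inf_valD mulrDl.
Qed.

(** The pairing of [act n f] with phi is n(f phi); if it vanishes for all interval indicators, then
    [act n f] is zero almost everywhere and every [m] kills it. *)
Lemma arens_eq0 n : (forall f a b, 0 < a -> a < b ->
    n (L0inf_conv f (cindic `]a, b])) = 0) ->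
  forall m, arens m n = 0.
Proof.
move=> n0 m; apply: dual_ext => f; rewrite arensE -[RHS](dual0 m).
apply: dual_ae_eq; apply: L0inf_ae_eq_itv => a b a0 ab.
have [phi1 _] := L1_cindic_itv w b (ltW a0).
rewrite -!(Cintegral_cindic _ (@sub_itv_DD _ a b (ltW a0))) actP// n0//.
rewrite -[LHS](mul0r (Cintegral DD (fun x => f x * cindic `]a, b] x))).
rewrite -CintegralZ ?measurable_itv//; last exact: cintegrable_mul_L1.
by apply: eq_Cintegral => x _; rewrite !mul0r.
Qed.

End action.

(** * Commutators are annihilated by left multiplications *)

Section commutation.
Context {R : realType} (w : weight R).
Local Notation mu := (@lebesgue_measure R).
Local Notation DD := (`[0%R, +oo[%classic : set R).
Implicit Types (f g : L0inf w) (m n : dual w) (phi psi : R -> R[i]).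

Lemma cintegrable_sum (D : set R) (I : Type) (r : seq I) (F : I -> R -> R[i]) :
  measurable D -> (forall i, cintegrable D (F i)) ->
  cintegrable D (fun x => \sum_(i <- r) F i x) /\
  Cintegral D (fun x => \sum_(i <- r) F i x) = \sum_(i <- r) Cintegral D (F i).
Proof.
move=> mD FI; elim: r => [|i r [IH1 IH2]].
  have E : (fun x => \sum_(i <- [::]) F i x) = fun=> 0 by apply/funext => x; rewrite big_nil.
  rewrite E big_nil; split; first by split; exact: integrable0.
  by rewrite /Cintegral /= /Rintegral integral0.
have E : (fun x => \sum_(j <- i :: r) F j x) = fun x => F i x + \sum_(j <- r) F j x.
  by apply/funext => x; rewrite big_cons.
by rewrite E big_cons -IH2; split; [exact: cintegrableD|exact: CintegralD].
Qed.

(* [b . g - \sum_i b(q_i) p_i] is small because its pairing with [phi] is the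
   value of [b] at [g phi - \sum_i <p_i, phi> q_i]. *)
Lemma dual_act_kernel (a b : dual w) (Ma Mb e : R) g (I : Type) (r : seq I)
    (p q : I -> L0inf w) :
  (forall f, normc (a f) <= Ma * normw w f) -> 0 < Ma ->
  (forall f, normc (b f) <= Mb * normw w f) -> 0 < Mb ->
  (forall x y, 0 <= x -> 0 <= y ->
    normc (g (x + y) - \sum_(i <- r) p i x * q i y) <= e * (w x * w y)) ->
  normc (a (act b g) - \sum_(i <- r) a (p i) * b (q i)) <= Ma * Mb * e.
Proof.
move=> aM Ma0 bM Mb0 gpq.
have e0 : 0 <= e.
  have := le_trans (normc_ge0 _) (gpq 0 0 (lexx 0) (lexx 0)).
  by rewrite weight0 !mulr1.
have mD : measurable DD by exact: measurable_itv.
have -> : \sum_(i <- r) a (p i) * b (q i) = a (\sum_(i <- r) b (q i) *: p i).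
  by rewrite dual_sum; apply: eq_bigr => i _; rewrite dualZ mulrC.
rewrite -dualB -mulrA; apply: le_trans (aM _) _; rewrite ler_wpM2l ?(ltW Ma0)//.
apply: normw_le_L1 => phi phi1.
pose c i := Cintegral DD (fun x => p i x * phi x).
have pI i : cintegrable DD (fun x => p i x * phi x) by exact: cintegrable_mul_L1.
have -> : Cintegral DD (fun x => (act b g - \sum_(i <- r) b (q i) *: p i) x * phi x) =
    b (L0inf_conv g phi - \sum_(i <- r) c i *: q i).
  rewrite dualB dual_sum -(actP b g phi1).
  have bpI i : cintegrable DD (fun x => b (q i) * (p i x * phi x)) by exact: cintegrableZ.
  have [sI sE] := cintegrable_sum r mD bpI.
  have -> : \sum_(i <- r) b (c i *: q i) =
      Cintegral DD (fun x => \sum_(i <- r) b (q i) * (p i x * phi x)).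
    by rewrite sE; apply: eq_bigr => i _; rewrite dualZ mulrC CintegralZ.
  rewrite -CintegralB//; last exact: cintegrable_mul_L1.
  apply: eq_Cintegral => x _; rewrite L0inf_valB mulrBl; congr (_ - _).
  by rewrite L0inf_val_sum mulr_suml; apply: eq_bigr => i _; rewrite L0inf_valZ mulrA.
apply: le_trans (bM _) _; rewrite -mulrA ler_wpM2l ?(ltW Mb0)//.
apply: normw_le; apply: aeW => y y0.
rewrite L0inf_valB (L0inf_convE phi1) L0inf_val_sum.
have [gI _] := conv_normw g phi1 y0.
have pqI i : cintegrable DD (fun x => q i y * (p i x * phi x)) by exact: cintegrableZ.
have [sI sE] := cintegrable_sum r mD pqI.
have -> : \sum_(i <- r) (c i *: q i) y =
    Cintegral DD (fun x => \sum_(i <- r) q i y * (p i x * phi x)).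
  by rewrite sE; apply: eq_bigr => i _; rewrite L0inf_valZ mulrC CintegralZ.
rewrite /conv -CintegralB//.
have /L1P[mphi phiI] := phi1.
rewrite mulrAC -RintegralZl//; apply: le_normc_Cintegral => //.
- by apply: cintegrable_measurable; exact: cintegrableB.
- by apply: integrable_EFinZ.
- by move=> x; rewrite /= in_itv/= andbT => x0; rewrite !mulr_ge0 ?weight_ge0 ?normc_ge0.
apply: aeW => x; rewrite /= in_itv/= andbT => x0.
have -> : g (y + x) * phi x - \sum_(i <- r) q i y * (p i x * phi x) =
    (g (x + y) - \sum_(i <- r) p i x * q i y) * phi x.
  rewrite mulrBl addrC [y + x]addrC [LHS]addrC; congr (_ - _).
  by rewrite mulr_suml; apply: eq_bigr => i _; rewrite mulrA [q i y * _]mulrC.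
rewrite normcM mulrA ler_wpM2r ?normc_ge0//.
by rewrite (le_trans (gpq _ _ x0 y0))// -mulrA ler_wpM2l// mulrC.
Qed.

(** Translation invariance moves the dependence on [z] from the integrand, which is merely
    measurable, to the end points of the window. *)
Lemma conv_cindic_itv f s t z : 0 <= s -> 0 <= z ->
  conv f (cindic `]s, t]) z = Cintegral `](z + s), (z + t)] f.
Proof.
move=> s0 z0; have [phi1 _] := L1_cindic_itv w t s0.
have [gI _] := conv_normw f phi1 z0.
have sD : `]s, t]%classic `<=` DD by exact: sub_itv_DD.
rewrite /conv (Cintegral_cindic (fun y => f (z + y)) sD).
have zsD : `](z + s), (z + t)]%classic `<=` DD by apply: sub_itv_DD; exact: addr_ge0.
have [fr fi] := cmeasurable_funS (measurable_itv _) zsD (L0inf_cmeasurable f).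
have pre : (fun y : R => z + y) @^-1` `](z + s), (z + t)] = `]s, t]%classic.
  by apply/seteqP; split => y /=; rewrite !in_itv/= ltrD2l lerD2l.
have [cr ci] : cintegrable `]s, t] (fun y => f (z + y)).
  have : cintegrable `]s, t] (fun y => f (z + y) * cindic `]s, t] y).
    by apply: cintegrableS gI => //; exact: measurable_itv.
  rewrite /cintegrable => -[r i]; split.
    apply: eq_integrable r => // y yst.
    by rewrite /= cindicE yst mulr1.
  apply: eq_integrable i => // y yst.
  by rewrite /= cindicE yst mulr1.
rewrite /Cintegral; congr (_ +i* _)%C; apply: esym.
  rewrite (Rintegral_shift (c := z)) ?pre//; exact: measurable_itv.
rewrite (Rintegral_shift (c := z)) ?pre//; exact: measurable_itv.
Qed.

Lemma L0inf_cintegrable_itv f a b : 0 <= a -> cintegrable `]a, b] f.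
Proof.
move=> a0; have aD := @sub_itv_DD _ a b a0.
apply: (@le_cintegrable _ _ _ (fun x => normw w f * w x)).
- exact: measurable_itv.
- by apply: cmeasurable_funS aD (L0inf_cmeasurable f); exact: measurable_itv.
- by apply: integrable_EFinZ; [exact: measurable_itv|exact: weight_integrable_itv].
- apply: (@filterS _ _ (ae_filter_ringOfSetsType mu) _ _ _ (ae_le_normw f)) => x fx /aD.
  by rewrite /= in_itv/= andbT => /fx.
Qed.

Lemma integrable_cst_itv (a b r : R) : mu.-integrable `]a, b] (EFin \o (fun=> r)).
Proof.
apply: measurable_bounded_integrable.
- exact: measurable_itv.
- have := @lebesgue_measure_itv R `]a, b]; rewrite /= => ->.
  by case: ifP => // _; rewrite -EFinD ltry.
- exact: measurable_cst.
- by exists `|r|; split; [exact: num_real|move=> M rM x _; exact: ltW].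
Qed.

Lemma Rintegral_cst_itv (a b r : R) : a <= b ->
  \int[mu]_(x in `]a, b]) r = r * (b - a).
Proof.
move=> ab; rewrite Rintegral_cst; last exact: measurable_itv.
have muab : fine (mu `]a, b]%classic) = b - a.
  rewrite lebesgue_measure_itv/= lte_fin; case: ltP => //= ba.
  by have /eqP -> : a == b; [rewrite eq_le ab ba|rewrite subrr].
by congr (_ * _); exact: muab.
Qed.

Lemma normc_Cintegral_itv f a b W : 0 <= a -> a <= b ->
  (forall x, a <= x -> x <= b -> w x <= W) ->
  normc (Cintegral `]a, b] f) <= normw w f * W * (b - a).
Proof.
move=> a0 ab wW; have aD := @sub_itv_DD _ a b a0.
have mab : measurable `]a, b]%classic by exact: measurable_itv.
rewrite -(Rintegral_cst_itv _ ab).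
have W0 : 0 <= W by rewrite (le_trans (weight_ge0 w a0))// wW.
apply: le_normc_Cintegral => //.
- by apply: cmeasurable_funS aD (L0inf_cmeasurable f); exact: measurable_itv.
- exact: integrable_cst_itv.
- by move=> x _; rewrite mulr_ge0 ?normw_ge0.
apply: (@filterS _ _ (ae_filter_ringOfSetsType mu) _ _ _ (ae_le_normw f)) => x fx xab.
have := aD _ xab; rewrite /= in_itv/= andbT => x0.
rewrite (le_trans (fx x0))// ler_wpM2l ?normw_ge0//.
by move: xab; rewrite /= in_itv/= => /andP[/ltW ax xb]; exact: wW.
Qed.

Lemma Cintegral_itvD f a b c : 0 <= a -> a <= b -> b <= c ->
  Cintegral `]a, c] f = Cintegral `]a, b] f + Cintegral `]b, c] f.
Proof.
move=> a0 ab bc; have [fr fi] := L0inf_cintegrable_itv f c a0.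
have rB := Rintegral_itvB fr (b := BRight c) (x := b).
have iB := Rintegral_itvB fi (b := BRight c) (x := b).
apply/eqP; rewrite addrC -subr_eq; apply/eqP; rewrite /Cintegral.
by rewrite -rB ?bnd_simp// -iB ?bnd_simp.
Qed.

(** Splitting []a, b']] at [b] and at [a'] gives both sides; the windows []a, b]] and []a', b']] may
    overlap or be disjoint. *)
Lemma Cintegral_itvB f a b a' b' : 0 <= a -> a <= b -> a <= a' -> b <= b' -> a' <= b' ->
  Cintegral `]a', b'] f - Cintegral `]a, b] f =
  Cintegral `]b, b'] f - Cintegral `]a, a'] f.
Proof.
move=> a0 ab aa' bb' a'b'.
have := Cintegral_itvD f a0 ab bb'; rewrite (Cintegral_itvD f a0 aa' a'b') => /eqP.
rewrite addrC -subr_eq => /eqP <-; rewrite opprB addrA; ring.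
Qed.

(** Moving the window changes the integral by two end pieces of length x' - x. There [f] is bounded
    by its norm times w(z), and w(z) <= w(z - y) w(y) with z - y in a bounded range, so [y] enters
    only through the factor [w y]. *)
Lemma conv_cindic_lipschitz f s t N : 0 <= s -> s <= t -> 0 <= N ->
  exists2 C, 0 < C & forall x x' y, 0 <= x -> x <= x' -> x' <= N -> 0 <= y ->
  normc (conv f (cindic `]s, t]) (x' + y) - conv f (cindic `]s, t]) (x + y)) <=
  C * (x' - x) * w y.
Proof.
(* On the end pieces z - y is at most x' + t, hence at most N + t. *)
move=> s0 st N0; have [W W0 wW] := weight_bounded w (N + t).
have nf0 := normw_ge0 f.
(* The factor 2 counts the two end pieces; the added 1 makes the constant positive. *)
exists (2 * (normw w f * W) + 1); first by rewrite ltr_wpDl// mulr_ge0// mulr_ge0// ltW.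
move=> x x' y x0 xx' x'N y0; have x'0 : 0 <= x' by exact: le_trans xx'.
have t0 : 0 <= t by exact: le_trans st.
rewrite !conv_cindic_itv ?addr_ge0//.
have piece v : 0 <= v -> v <= t ->
    normc (Cintegral `](x + y + v), (x' + y + v)] f) <= normw w f * W * (x' - x) * w y.
  move=> v0 vt.
  have -> : normw w f * W * (x' - x) * w y =
      normw w f * (W * w y) * ((x' + y + v) - (x + y + v)) by ring.
  apply: normc_Cintegral_itv; first by rewrite !addr_ge0.
    by rewrite !lerD2r.
  move=> z xz zx'.
  have zy0 : 0 <= z - y by rewrite subr_ge0 (le_trans _ xz)// -addrA addrCA lerDl addr_ge0.
  rewrite -[z](subrK y) (le_trans (weight_submul w zy0 y0))// ler_wpM2r ?weight_ge0//.
  by apply: wW => //; rewrite lerBlDr (le_trans zx')//; lra.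
rewrite Cintegral_itvB; last 5 first.
- by rewrite !addr_ge0.
- by rewrite lerD2l.
- by rewrite !lerD2r.
- by rewrite !lerD2r.
- by rewrite lerD2l.
rewrite (le_trans (le_normcD _ _))// normcN.
apply: (le_trans (lerD (piece t t0 (lexx t)) (piece s s0 st))).
rewrite -mulrDl -mulrDl ler_wpM2r ?weight_ge0//.
by rewrite ler_wpM2r ?subr_ge0// mulr_natl mulr2n lerDl.
Qed.

Lemma cindic_isL0inf (E : set R) N : measurable E ->
  (forall x, E x -> x <= N) -> isL0inf w (cindic E).
Proof.
move=> mE EN; apply: (@isL0infI _ _ _ 1).
- exact: cmeasurable_cindic.
- apply: aeW => x x0; rewrite mul1r cindicE; case: ifP => _; last by rewrite normc0 weight_ge0.
  by rewrite normc1 weight_ge1.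
- move=> e e0; exists N; apply: aeW => x x0 Nx; rewrite cindicE memNset.
    by rewrite normc0 mulr_ge0 ?weight_ge0// ltW.
  by move=> /EN; rewrite leNgt Nx.
Qed.

(** The half-open cells [i d, (i+1) d[ are disjoint and cover [0, K d[, so the sum is a step
    function with at most one surviving term. *)
Lemma sum_cindic_step (G : nat -> R[i]) K (d x : R) : 0 < d -> 0 <= x ->
  (x < K%:R * d -> exists i, [/\ (i < K)%N, i%:R * d <= x, x < i.+1%:R * d &
     \sum_(0 <= i < K) cindic `[(i%:R * d), (i.+1%:R * d)[ x * G i = G i]) /\
  (K%:R * d <= x -> \sum_(0 <= i < K) cindic `[(i%:R * d), (i.+1%:R * d)[ x * G i = 0).
Proof.
move=> d0 x0; elim: K => [|K [IH1 IH2]].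
  split; first by rewrite mul0r ltNge x0.
  by rewrite big_geq.
rewrite big_nat_recr//= cindicE; split => [xK|Kx].
  have [Kx|xlK] := leP (K%:R * d) x.
    exists K; split => //; rewrite IH2// add0r mem_set ?mul1r//=.
    by rewrite in_itv/= Kx.
  have [i [iK ix xi iE]] := IH1 xlK; exists i; split => //; first exact: ltnW.
  rewrite iE memNset ?mul0r ?addr0//= in_itv/=.
  by rewrite leNgt xlK.
rewrite IH2 ?add0r; last by rewrite (le_trans _ Kx)// ler_wpM2r ?(ltW d0)// ler_nat.
rewrite memNset ?mul0r//= in_itv/= => /andP[_].
by rewrite ltNge Kx.
Qed.

(** The finite rank kernel replaces [x] by the left end of its cell in a grid of [0, X + 1[ and is
    zero beyond. On the grid the error is at most C d w(y) <= e w(y), and w(x) >= 1; beyond it the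
    tail bound gives e w(x + y) <= e w(x) w(y). *)
Lemma conv_cindic_kernel f s t e : 0 <= s -> s <= t -> 0 < e ->
  exists (K : nat) (p q : nat -> L0inf w), forall x y, 0 <= x -> 0 <= y ->
  normc (conv f (cindic `]s, t]) (x + y) - \sum_(i <- index_iota 0 K) p i x * q i y) <=
  e * (w x * w y).
Proof.
move=> s0 st e0; have [phi1 _] := L1_cindic_itv w t s0.
have [X X0 gX] := conv_tail f phi1 e0.
(* [X] may be 0; [X + 1] keeps the mesh positive. *)
have [C C0 gC] := conv_cindic_lipschitz f s0 st (N := X + 1) (addr_ge0 X0 ler01).
(* Enough cells for the mesh [d] to satisfy [C * d <= e]. *)
pose K := (Num.bound (C * (X + 1) / e)).+1.
have X1 : 0 < X + 1 by rewrite ltr_wpDl.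
have K0 : 0 < K%:R :> R by rewrite ltr0n.
have CK : C * ((X + 1) / K%:R) <= e.
  rewrite mulrA ler_pdivrMr// mulrC -ler_pdivrMl// mulrC.
  have := archi_boundP (ltW (divr_gt0 (mulr_gt0 C0 X1) e0)).
  by move=> /ltW h; rewrite [e^-1 * _]mulrC (le_trans h)// ler_nat.
pose d := (X + 1) / K%:R.
have d0 : 0 < d by rewrite divr_gt0.
have Kd : K%:R * d = X + 1 by rewrite /d mulrC divfK// gt_eqF.
have pL (i : nat) : isL0inf w (cindic `[(i%:R * d), (i.+1%:R * d)[).
  apply: (@cindic_isL0inf _ (i.+1%:R * d)); first exact: measurable_itv.
  by move=> x /=; rewrite in_itv/= => /andP[_ /ltW].
pose p i := mkL0inf (mem_set (pL i) : _ \in L0inf_pred w).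
(* With g = f 1_]s,t], [q i] is the translate y |-> g(i d + y); written as a convolution with the
   shifted interval, it is in L_0^oo(w) at once. *)
pose q (i : nat) := L0inf_conv f (cindic `](i%:R * d + s), (i%:R * d + t)]).
exists K, p, q => x y x0 y0.
have qE i : q i y = conv f (cindic `]s, t]) (i%:R * d + y).
  have id0 : 0 <= i%:R * d by rewrite mulr_ge0// ltW.
  have [phii _] := L1_cindic_itv w (i%:R * d + t) (addr_ge0 id0 s0).
  apply: (etrans (L0inf_convE phii f y)).
  by rewrite !conv_cindic_itv ?addr_ge0// ![y + (_ + _)]addrA ![y + _]addrC.
have [lt_x ge_x] := sum_cindic_step (fun i => q i y) K d0 x0.
have [Kx|xK] := leP (K%:R * d) x.
  rewrite [X in _ - X]ge_x// subr0 (le_trans (gX _ _))//.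
    by rewrite (le_trans _ (lerD Kx y0))// Kd addr0 lerDl.
  by rewrite ler_wpM2l ?(ltW e0)// weight_submul.
have [i [iK ix xi E]] := lt_x xK.
rewrite [X in _ - X]E qE.
have id0 : 0 <= i%:R * d by rewrite mulr_ge0// ltW.
have xN : x <= X + 1 by rewrite -Kd ltW.
apply: (le_trans (gC _ _ _ id0 ix xN y0)).
rewrite [leRHS]mulrA ler_wpM2r ?weight_ge0//.
apply: (@le_trans _ _ (C * d)).
  rewrite ler_wpM2l ?(ltW C0)// lerBlDr (le_trans (ltW xi))//.
  by rewrite -natr1 mulrDl mul1r addrC.
by rewrite (le_trans CK)// ler_peMr ?(ltW e0)// weight_ge1.
Qed.

(* A finite rank approximation of the kernel [(x, y) |-> g (x + y)] can be read
   in both orders since the kernel is symmetric. *)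
Lemma dual_act_comm (a b : dual w) f s t : 0 <= s -> s <= t ->
  a (act b (L0inf_conv f (cindic `]s, t]))) = b (act a (L0inf_conv f (cindic `]s, t]))).
Proof.
move=> s0 st; set g := L0inf_conv f _.
have [phi1 _] := L1_cindic_itv w t s0.
have gE z : g z = conv f (cindic `]s, t]) z := L0inf_convE phi1 f z.
have [Ma Ma0 aM] := dual_bounded a; have [Mb Mb0 bM] := dual_bounded b.
apply/eqP; rewrite -subr_eq0; apply/eqP/eq0_normc/le_anti; rewrite normc_ge0 andbT.
apply/ler_addgt0Pr => e e0; rewrite add0r.
(* Each of the two approximations below costs [Ma * Mb] times the tolerance, hence half of [e]. *)
have M0 : 0 < 2 * (Ma * Mb) by rewrite !mulr_gt0.
have [K [p [q gpq]]] := conv_cindic_kernel f s0 st (divr_gt0 e0 M0).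
have ab := dual_act_kernel (g := g) aM Ma0 bM Mb0 (r := index_iota 0 K) (p := p) (q := q)
  (e := e / (2 * (Ma * Mb))) _.
have ba := dual_act_kernel (g := g) bM Mb0 aM Ma0 (r := index_iota 0 K) (p := q) (q := p)
  (e := e / (2 * (Ma * Mb))) _.
set S := \sum_(i <- index_iota 0 K) a (p i) * b (q i) in ab.
have -> : a (act b g) - b (act a g) = (a (act b g) - S) - (b (act a g) - S) by ring.
rewrite (le_trans (le_normcD _ _))// normcN.
have -> : e = Ma * Mb * (e / (2 * (Ma * Mb))) + Mb * Ma * (e / (2 * (Ma * Mb))).
  by field; rewrite !gt_eqF.
apply: lerD.
  by apply: ab => x y x0 y0; rewrite gE; exact: gpq.
have -> : S = \sum_(i <- index_iota 0 K) b (q i) * a (p i).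
  by apply: eq_bigr => i _; rewrite mulrC.
apply: ba => x y x0 y0; rewrite gE [x + y]addrC [w x * w y]mulrC.
have -> : \sum_(i <- index_iota 0 K) q i x * p i y =
    \sum_(i <- index_iota 0 K) p i y * q i x.
  by apply: eq_bigr => i _; rewrite mulrC.
exact: gpq.
Qed.

(** By [arens_eq0] it is enough that the commutator vanishes on the elements f phi, which is the
    symmetry [dual_act_comm]. *)
Lemma arens_commutator m a b : arens m (commutator a b) = 0.
Proof.
apply: arens_eq0 => f s t s0 st; rewrite /commutator dual_valB !arensE.
by apply/eqP; rewrite subr_eq0; apply/eqP/dual_act_comm; exact: ltW.
Qed.

End commutation.

(** * Right identities *)

Section existence_of_right_identity.
Context {R : realType} (w : weight R).
Local Notation mu := (@lebesgue_measure R).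
Local Notation DD := (`[0%R, +oo[%classic : set R).
Implicit Types (f g : L0inf w) (m : dual w) (n : nat).

(** By compactness of [[- B, B]] the image filter has a cluster point, and along an ultrafilter a
    cluster point is a limit. *)
Lemma ultrafilter_bounded_cvg (U : set_system nat) (r : nat -> R) (B : R) :
  UltraFilter U -> (forall n, `|r n| <= B) -> cvg (r n @[n --> U]).
Proof.
move=> UU rB.
have UF : ProperFilter (r @ U) by exact: fmap_proper_filter.
have UB : (r @ U) `[- B, B]%classic.
  by apply: (@filterE _ U) => n /=; rewrite in_itv/= -ler_norml.
have [p [_ pr]] := @segment_compact R (- B) B (r @ U) UF UB.
apply/cvg_ex; exists p => V pV.
have [//|UV] := in_ultra_setVsetC (r @^-1` V) UU.
by have [z [nVz Vz]] := pr (~` V) V UV pV.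
Qed.

Definition avg0 (n : nat) (f : R -> R[i]) : R[i] :=
  (n.+1%:R)%:C%C * Cintegral `]0, n.+1%:R^-1] f.

Lemma avg0_linear n a f g : avg0 n (a *: f + g) = a * avg0 n f + avg0 n g.
Proof.
have fI := L0inf_cintegrable_itv f n.+1%:R^-1 (lexx 0).
have gI := L0inf_cintegrable_itv g n.+1%:R^-1 (lexx 0).
have mI : measurable `]0, (n.+1%:R^-1 : R)]%classic by exact: measurable_itv.
rewrite /avg0 mulrCA -mulrDr; congr (_ * _).
by rewrite -CintegralZ// -CintegralD//; exact: cintegrableZ.
Qed.

Lemma avg0_bounded : exists2 W, 0 < W & forall n f, normc (avg0 n f) <= W * normw w f.
Proof.
have [W W0 wW] := weight_bounded w 1; exists W => // n f.
have d0 : 0 < n.+1%:R^-1 :> R by rewrite invr_gt0.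
have := normc_Cintegral_itv f (W := W) (lexx 0) (ltW d0) _.
rewrite subr0 => H; have {}H := H _.
rewrite /avg0 normcZr ger0_norm//.
rewrite -ler_pdivlMl// mulrC [W * _]mulrC; apply: H => x x0 xn.
by apply: wW => //; rewrite (le_trans xn)// invf_le1// ler1n.
Qed.

(** The Lipschitz bound on [0, 1] makes the mean over ]0, 1/(n+1)] differ from the value at 0 by at
    most C/(n+1). *)
Lemma cvg_avg0_conv f s t : 0 <= s -> s <= t ->
  normc (avg0 n (conv f (cindic `]s, t])) - conv f (cindic `]s, t]) 0) @[n --> \oo] --> 0.
Proof.
move=> s0 st; have [C C0 gC] := conv_cindic_lipschitz f s0 st ler01.
set g := conv f _; have [phi1 _] := L1_cindic_itv w t s0.
have C_cvg : C * n.+1%:R^-1 @[n --> \oo] --> 0.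
  by rewrite -[X in _ --> X](mulr0 C); apply: cvgMr; exact: cvg_harmonic.
apply: (squeeze_cvgr _ (cvg_cst 0) C_cvg); apply: nearW => n.
rewrite normc_ge0 andTb; set d : R := n.+1%:R^-1.
have d0 : 0 < d by rewrite invr_gt0.
have mI : measurable `]0, d]%classic by exact: measurable_itv.
have cst_d (r : R) : \int[mu]_(x in `]0, d]) r = r * d.
  by rewrite (Rintegral_cst_itv _ (ltW d0)) subr0.
have gI : cintegrable `]0, d] g.
  have := L0inf_cintegrable_itv (L0inf_conv f (cindic `]s, t])) d (lexx 0).
  congr (cintegrable _ _); apply/funext => z; exact: L0inf_convE.
have cI : cintegrable `]0, d] (fun=> g 0) by split; exact: integrable_cst_itv.
have cE : Cintegral `]0, d] (fun=> g 0) = d%:C%C * g 0.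
  rewrite /Cintegral !cst_d; case: (g 0) => x y.
  by apply/eqP; rewrite eq_complex/= !mul0r subr0 addr0 ![d * _]mulrC !eqxx.
have -> : avg0 n g - g 0 = (n.+1%:R)%:C%C * Cintegral `]0, d] (fun x => g x - g 0).
  rewrite CintegralB// mulrBr cE mulrA -rmorphM /= mulfV ?mul1r//.
rewrite normcZr ger0_norm//.
have : normc (Cintegral `]0, d] (fun x => g x - g 0)) <= \int[mu]_(x in `]0, d]) (C * d).
  apply: le_normc_Cintegral => //.
  - by apply: cintegrable_measurable; exact: cintegrableB.
  - exact: integrable_cst_itv.
  - by move=> x _; rewrite mulr_ge0// ltW.
  apply: aeW => x; rewrite /= in_itv/= => /andP[x0 xd].
  have d1 : d <= 1 by rewrite invf_le1// ler1n.
  have := gC 0 x 0 (lexx 0) (ltW x0) (le_trans xd d1) (lexx 0).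
  rewrite !addr0 weight0 mulr1 subr0 => /le_trans; apply.
  by rewrite ler_wpM2l// ltW.
rewrite cst_d => H.
rewrite (le_trans (ler_wpM2l _ H))// mulrCA [n.+1%:R * d]mulfV ?mulr1//.
Qed.

(* A weak-star cluster point of the approximate identity [n 1_]0,1/n]]. *)
Lemma exists_right_identity : exists u : dual w, forall m, arens m u = m.
Proof.
have [U [UU oU]] := @ultraFilterLemma nat \oo _.
have [W W0 aW] := avg0_bounded.
pose re f n := complex.Re (avg0 n f); pose im f n := complex.Im (avg0 n f).
have re_cvg f : cvg (re f n @[n --> U]).
  apply: (@ultrafilter_bounded_cvg _ _ (W * normw w f)) => n.
  by rewrite (le_trans (Re_le_normc _)).
have im_cvg f : cvg (im f n @[n --> U]).
  apply: (@ultrafilter_bounded_cvg _ _ (W * normw w f)) => n.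
  by rewrite (le_trans (Im_le_normc _)).
(* Along the single ultrafilter [U] the limits exist for all [f] at once, so linearity passes to
   [u0]. *)
pose u0 f : R[i]^o := (lim (re f n @[n --> U]) +i* lim (im f n @[n --> U]))%C.
have u0P : isdual u0.
  split.
    move=> a f g; rewrite /u0.
    have -> : lim (re (a *: f + g) n @[n --> U]) =
        complex.Re a * lim (re f n @[n --> U]) - complex.Im a * lim (im f n @[n --> U]) +
        lim (re g n @[n --> U]).
      apply: cvg_lim => //.
      rewrite (_ : re (a *: f + g) =
        (fun n => complex.Re a * re f n - complex.Im a * im f n + re g n)); last first.
        apply/funext => n; rewrite /re /im avg0_linear raddfD.
        by case: a (avg0 n f) => [? ?] [? ?].
      apply: cvgD; last exact: re_cvg.
      by apply: cvgB; apply: cvgMr; [exact: re_cvg|exact: im_cvg].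
    have -> : lim (im (a *: f + g) n @[n --> U]) =
        complex.Re a * lim (im f n @[n --> U]) + complex.Im a * lim (re f n @[n --> U]) +
        lim (im g n @[n --> U]).
      apply: cvg_lim => //.
      rewrite (_ : im (a *: f + g) =
        (fun n => complex.Re a * im f n + complex.Im a * re f n + im g n)); last first.
        apply/funext => n; rewrite /re /im avg0_linear raddfD.
        by case: a (avg0 n f) => [? ?] [? ?].
      apply: cvgD; last exact: im_cvg.
      by apply: cvgD; apply: cvgMr; [exact: im_cvg|exact: re_cvg].
    by case: a => x y; apply/eqP; rewrite eq_complex/= !eqxx.
  exists (W + W) => f; rewrite (le_trans (normc_le_ReIm _))// mulrDl.
  have lim_le (r : nat -> R) : cvg (r n @[n --> U]) ->
      (forall n, `|r n| <= W * normw w f) -> `|lim (r n @[n --> U])| <= W * normw w f.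
    move=> rU rW; rewrite ler_norml; apply/andP; split.
      apply: limr_ge => //; apply: filterE => n.
      by have := rW n; rewrite ler_norml => /andP[].
    apply: limr_le => //; apply: filterE => n.
    by have := rW n; rewrite ler_norml => /andP[].
  by apply: lerD; apply: lim_le => // n;
    [rewrite (le_trans (Re_le_normc _))|rewrite (le_trans (Im_le_normc _))].
pose u : dual w := mkdual (mem_set u0P : u0 \in @dual_pred R w).
(* On f phi the means converge in the ordinary sense, so the limit does not depend on [U]: [u]
   evaluates at 0. *)
have uE f s t : 0 <= s -> s <= t ->
    u (L0inf_conv f (cindic `]s, t])) = conv f (cindic `]s, t]) 0.
  move=> s0 st; have [phi1 _] := L1_cindic_itv w t s0.
  have gE : L0inf_conv f (cindic `]s, t]) = conv f (cindic `]s, t]) :> (R -> R[i]).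
    by apply/funext => z; exact: L0inf_convE.
  have av := cvg_avg0_conv f s0 st.
  have limE (p : R[i] -> R) : (forall z z', p (z - z') = p z - p z') ->
      (forall z, `|p z| <= normc z) ->
      lim (p (avg0 n (conv f (cindic `]s, t]))) @[n --> U]) = p (conv f (cindic `]s, t]) 0).
    move=> pB p_le; apply: cvg_lim => //.
    suff : p (avg0 n (conv f (cindic `]s, t]))) @[n --> \oo] -->
        p (conv f (cindic `]s, t]) 0).
      by apply: cvg_trans => V; exact: oU.
    apply/cvgrPdist_le => e e0; move/cvgrPdist_le : av => /(_ _ e0).
    apply: filterS => n; rewrite sub0r normrN => /(le_trans (ler_norm _)).
    by apply: le_trans; rewrite distrC -pB.
  rewrite -[LHS]/(u0 (L0inf_conv f (cindic `]s, t]))) /u0 /re /im gE.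
  rewrite (limE (@complex.Re R)); [|by move=> z z'; rewrite raddfB|exact: Re_le_normc].
  rewrite (limE (@complex.Im R)); [|by move=> z z'; rewrite raddfB|exact: Im_le_normc].
  by case: (conv _ _ _).
(* (f phi)(0) is the integral of [f] over the interval, so [act u f] and [f] have the same integrals
   over intervals. *)
exists u => m; apply: dual_ext => f; rewrite arensE; apply: dual_ae_eq.
apply: L0inf_ae_eq_itv => a b a0 ab.
apply: (etrans (Cintegral_act u f b a0)); rewrite uE ?(ltW a0) ?(ltW ab)//.
by rewrite conv_cindic_itv ?(ltW a0)// !add0r.
Qed.

End existence_of_right_identity.

(** * Centralizing and commuting theta-derivations *)

Theorem theorem2p7 (R : realType) (w : weight R) (k : nat)
    (theta D : {linear dual w -> dual w}) :
  (0 < k)%N -> is_homomorphism theta -> is_derivation theta D ->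
  (k_centralizing k D <-> k_commuting k D) /\
  (k_centralizing k D -> is_isometric_isomorphism theta ->
   forall u : dual w, Lambda u ->
     (forall m, right_ideal u (D m)) /\
     (forall m, D m = arens (theta u) (D m))).
Proof.
move=> k0 thetaM Dder.
have [e eP] := exists_right_identity w.
(* [act 0 f] is again a chosen representative, so this is drawn from additivity rather than from the
   definition. *)
have arens0r (m : dual w) : arens m 0 = 0.
  by have := arensDr m 0 0; rewrite addr0 => /eqP; rewrite -subr_eq subrr eq_sym => /eqP.
have cent_com : k_centralizing k D <-> k_commuting k D.
  split=> Dk m; last first.
    by move=> x; rewrite Dk arens0l arens0r.
  by rewrite -[LHS]eP Dk arens_commutator.
split=> // /cent_com Dk [_ [theta' thetaK theta'K] _] u [uP _].
(* Right identities are idempotent, so commuting with their k-th power is commuting with themselves;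
   positivity of [k] excludes the zeroth power, which is 0. *)
have expk (v : dual w) : arens v v = v -> arens_exp v k = v.
  by case: k k0 {Dk cent_com} => // j _ vv; rewrite /arens_exp /=; elim: j => //= j ->.
have Did (v : dual w) : (forall m, arens m v = m) -> D v = 0.
  move=> vP.
  have thetaDv m : arens (theta m) (D v) = 0.
    have := Dder m v; rewrite vP.
    (* By surjectivity [D m] is a value of [theta], and [theta] carries the identity x v = x over to
       its values. *)
    have -> : arens (D m) (theta v) = D m.
      by rewrite -{1}[D m]theta'K -thetaM vP theta'K.
    by move=> /eqP; rewrite -subr_eq0 opprD addrA subrr add0r oppr_eq0 => /eqP.
  have vDv : arens v (D v) = 0 by have := thetaDv (theta' v); rewrite theta'K.
  by have := Dk v; rewrite /commutator expk// vP vDv subr0.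
have Dann (n : dual w) : (forall m, arens m n = 0) -> D n = 0.
  move=> n0; have := Did (u + n).
  rewrite linearD Did// add0r; apply=> m.
  by rewrite arensDr uP n0 addr0.
have Dleft (v : dual w) : (forall m, arens m v = m) -> forall m, D m = arens (theta v) (D m).
  move=> vP m; have := Dann (commutator v m) (fun x => arens_commutator x v m).
  rewrite /commutator linearB vP Dder Did// arens0l add0r => /eqP.
  by rewrite subr_eq0 => /eqP.
split=> m; last exact: Dleft.
(* [D m] is its own preimage: u D(m) = D(m) is [Dleft] for [theta' u], a right identity by
   injectivity of [theta]. *)
exists (D m) => //; rewrite -[u in LHS]theta'K -Dleft// => x.
apply: (can_inj thetaK); by rewrite thetaM theta'K uP.
Qed.
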